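(* Assume that $X$ is of Pareto-type with index $\alpha=2$, i.e. $1-F(x)\sim x^{-2}\ell(x)$ as $x\to\infty$ with $\ell$ slowly varying, that $\mu_2=\infty$, and that the counting process $\{N(t);\,t\geq 0\}$ $\mathcal{D}$-averages in time to the random variable $\Lambda$. Define $(a^\prime_t)_{t>0}$ by $\lim_{t\to\infty}t\,(a^{\prime}_t)^{-2}\tilde\ell(a^\prime_t)=1$ with $\tilde\ell(x)=\int_0^x\frac{\ell(u)}{u}\,du\in\mathrm{RV}_0$. Then $$\frac{N(t)}{(a^{\prime}_t)^2}\,C_{N(t)}\stackrel{\mathcal{D}}{\longrightarrow}\frac{2}{\mu_1}\,\Lambda\quad\text{and}\quad\frac{N(t)}{(a^{\prime}_t)^2}\,\widehat{\mathrm{D}(X)}\stackrel{\mathcal{D}}{\longrightarrow}\frac{2}{\mu_1}\,\Lambda\quad\text{as } t\rightarrow\infty,$$ and $$\frac{t}{(a^{\prime}_t)^2}\,\widehat{\mathrm{D}(X)}\stackrel{\mathcal{D}}{\longrightarrow}\frac{2}{\mu_1}\quad\text{as } t\rightarrow\infty.$$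
   Context: $X$ is a positive random variable with distribution function $F$ and $\mu_\beta:=\mathbb{E}X^\beta\le\infty$; $X_1,X_2,\ldots$ are i.i.d. copies of $X$; $\{N(t);\,t\geq 0\}$ is a counting process (nonnegative integer-valued, nondecreasing in $t$) independent of the $X_i$'s. For fixed $t\ge0$, $C_{N(t)}:=\frac{X_1^2+\cdots+X_{N(t)}^2}{X_1+\cdots+X_{N(t)}}$ if $N(t)\ge1$ and $C_{N(t)}:=0$ otherwise. The sample dispersion based on $X_1,\ldots,X_{N(t)}$ is $\widehat{\mathrm{D}(X)}:=S^2/\overline X$, where $\overline X:=\frac{1}{N(t)}\sum_{i=1}^{N(t)}X_i$ and $S^2:=\frac{1}{N(t)}\sum_{i=1}^{N(t)}(X_i-\overline X)^2$; on $\{N(t)=0\}$ it is set to $0$. $X$ (or $F$) is of Pareto-type with index $\alpha>0$ if $1-F(x)\sim x^{-\alpha}\ell(x)$ as $x\to\infty$ for a slowly varying function $\ell$. $\mathrm{RV}_0$ is the class of slowly varying functions. The counting process $\mathcal{D}$-averages in time to $\Lambda$ if $N(t)/t\stackrel{\mathcal{D}}{\longrightarrow}\Lambda$ (convergence in distribution) as $t\to\infty$, where $\mathbb{P}[\Lambda>0]=1$.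
   Formalization: The normalizing function a'_t is additionally assumed to tend to infinity (the limit relation alone also admits a'_t → 0 for some ℓ, where the claim fails), and ℓ(u)/u is assumed integrable on (0,x] so that ℓ̃ is defined. *)

(* Defs.v *)
From HB Require Import structures.
From mathcomp Require Import all_boot all_order all_algebra finmap.
From mathcomp Require Import all_classical all_reals all_analysis.
From mathcomp Require Import measurable_realfun.

Set Implicit Arguments.
Unset Strict Implicit.
Unset Printing Implicit Defensive.

Import Order.TTheory GRing.Theory Num.Theory.
Import numFieldNormedType.Exports.

Local Open Scope classical_set_scope.
Local Open Scope ring_scope.

(* Only the values of [l] on ]0, +oo[ matter; positivity is required
   ultimately. *)
Definition slowly_varying (R : realType) (l : R -> R) : Prop :=
  [/\ measurable_fun (`]0, +oo[ : set R) l,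
      \forall x \near +oo, 0 < l x &
      forall c, 0 < c -> l (c * x) / l x @[x --> +oo] --> (1 : R)].

(* 1 - F(x) ~ x^(- alpha) l(x) as x -> oo, with F the distribution function
   of X; the denominator of the quotient is ultimately positive. *)
Definition pareto_type d (T : measurableType d) (R : realType)
    (P : probability T R) (X : {RV P >-> R}) (alpha : R) (l : R -> R) : Prop :=
  slowly_varying l /\
  (1 - fine (cdf X x)) / (x `^ (- alpha) * l x) @[x --> +oo] --> (1 : R).

(* Integral of l(u)/u over ]0, x], meaningful when l(u)/u is integrable
   there. *)
Definition ltilde (R : realType) (l : R -> R) (x : R) : R :=
  \int[lebesgue_measure]_(u in `]0, x]) (l u / u).

(* Convergence in distribution as t -> +oo: pointwise convergence of the
   distribution functions at the continuity points of the limit. The limit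
   may live on another probability space. *)
Definition cvg_in_dist d d' (T : measurableType d) (T' : measurableType d')
    (R : realType) (P : probability T R) (P' : probability T' R)
    (Y : R -> {RV P >-> R}) (L : {RV P' >-> R}) : Prop :=
  forall x : R, {for x, continuous (cdf L)} ->
    cdf (Y t) x @[t --> +oo] --> cdf L x.
Arguments cvg_in_dist {d d' T T' R} P P' Y L.

Definition mutually_independent d (T : measurableType d) (R : realType)
    (P : probability T R) (X : nat -> {RV P >-> R}) : Prop :=
  forall (J : {fset nat}) (B : nat -> set R),
    (forall i, measurable (B i)) ->
    P (\bigcap_(i in [set` J]) (X i @^-1` B i)) =
    (\prod_(i <- J) P (X i @^-1` B i))%E.

Definition iid_copies d (T : measurableType d) (R : realType)
    (P : probability T R) (X : {RV P >-> R}) (Xs : nat -> {RV P >-> R}) : Prop :=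
  mutually_independent Xs /\
  forall i (B : set R), measurable B ->
    distribution P (Xs i) B = distribution P X B.

Definition sigma_of d d' (T : measurableType d) (T' : measurableType d')
    (I : Type) (D : set I) (Y : I -> T -> T') : set (set T) :=
  <<s \bigcup_(i in D) preimage_set_system setT (Y i) measurable >>.

(* The process (N t), t >= 0, as a whole, is independent of the sequence Xs. *)
Definition independent_process d (T : measurableType d) (R : realType)
    (P : probability T R) (N : R -> {mfun T >-> nat})
    (Xs : nat -> {RV P >-> R}) : Prop :=
  forall A B : set T,
    sigma_of [set t | 0 <= t] N A -> sigma_of setT Xs B ->
    P (A `&` B) = (P A * P B)%E.
Arguments iid_copies {d T R} P X Xs.
Arguments independent_process {d T R} P N Xs.
Arguments pareto_type {d T R} P X alpha l.

Definition counting_process d (T : measurableType d) (R : realType)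
    (N : R -> {mfun T >-> nat}) : Prop :=
  forall s t w, 0 <= s -> s <= t -> (N s w <= N t w)%N.

(* Samples are indexed from 0: the first n observations are x 0, ..., x n.-1. *)
Section sample_statistics.
Context {R : realType}.
Implicit Types (x : nat -> R) (n : nat).

Definition sample_mean x n : R := n%:R^-1 * \sum_(i < n) x i.

Definition sample_variance x n : R :=
  n%:R^-1 * \sum_(i < n) (x i - sample_mean x n) ^+ 2.

Definition sample_dispersion x n : R :=
  if n == 0%N then 0 else sample_variance x n / sample_mean x n.

Definition sample_C x n : R :=
  if n == 0%N then 0 else (\sum_(i < n) x i ^+ 2) / \sum_(i < n) x i.

End sample_statistics.

Section random_sample_size.
Context d (T : measurableType d) (R : realType).
Implicit Types (N : {mfun T >-> nat}) (X : nat -> {mfun T >-> R}).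

Definition countR N : T -> R := fun w => (N w)%:R.
Definition rC X N : T -> R := fun w => sample_C (X ^~ w) (N w).
Definition rdispersion X N : T -> R :=
  fun w => sample_dispersion (X ^~ w) (N w).

Lemma measurable_random_index (f : nat -> T -> R) N :
  (forall n, measurable_fun setT (f n)) ->
  measurable_fun setT (fun w => f (N w) w).
Proof.
move=> mf _ B mB; rewrite setTI.
rewrite (_ : _ @^-1` _ = \bigcup_n (N @^-1` [set n] `&` f n @^-1` B)).
  apply: bigcup_measurable => n _; apply: measurableI.
    by rewrite -[X in measurable X]setTI; exact: measurable_funP.
  by rewrite -[X in measurable X]setTI; exact: mf.
by apply/seteqP; split => [w Bw|w [n _ [/= <-]]]//; exists (N w).
Qed.

Lemma measurable_inv : measurable_fun [set: R] (@GRing.inv R).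
Proof.
rewrite -(setvU [set (0 : R)]); apply/measurable_funU => //.
  exact: measurableC.
split; last exact: measurable_fun_set1.
apply: open_continuous_measurable_fun => //.
  exact/closed_openC/closed_eq.
by move=> x; rewrite inE => /eqP x0; exact: inv_continuous.
Qed.

Lemma measurable_countR N : measurable_fun setT (countR N).
Proof. by apply: (measurable_random_index (f := fun n _ => n%:R)). Qed.

Lemma measurable_rC X N : measurable_fun setT (rC X N).
Proof.
apply: (measurable_random_index (f := fun n w => sample_C (X ^~ w) n)) => n.
rewrite /sample_C; case: eqP => // _; apply: measurable_funM.
  by apply: measurable_sum => i; exact: measurable_funX.
apply: (measurableT_comp measurable_inv).
by apply: measurable_sum => i; exact: measurable_funP.
Qed.

Lemma measurable_rdispersion X N : measurable_fun setT (rdispersion X N).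
Proof.
apply: (measurable_random_index
  (f := fun n w => sample_dispersion (X ^~ w) n)) => n.
have mmean : measurable_fun setT (fun w => sample_mean (X ^~ w) n).
  apply: measurable_funM => //.
  by apply: measurable_sum => i; exact: measurable_funP.
rewrite /sample_dispersion; case: eqP => // _; apply: measurable_funM.
  apply: measurable_funM => //; apply: measurable_sum => i.
  by apply: measurable_funX; exact: measurable_funB.
exact: (measurableT_comp measurable_inv).
Qed.

HB.instance Definition _ N :=
  isMeasurableFun.Build _ _ T R (countR N) (measurable_countR N).
HB.instance Definition _ X N :=
  isMeasurableFun.Build _ _ T R (rC X N) (measurable_rC X N).
HB.instance Definition _ X N :=
  isMeasurableFun.Build _ _ T R (rdispersion X N) (measurable_rdispersion X N).

End random_sample_size.
Arguments countR {d T R} N.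

(* N(t)/t -> L in distribution, with P[L > 0] = 1. *)
Definition D_averages_in_time d d' (T : measurableType d)
    (T' : measurableType d') (R : realType) (P : probability T R)
    (P' : probability T' R) (N : R -> {mfun T >-> nat})
    (L : {RV P' >-> R}) : Prop :=
  P' [set w | 0 < L w] = 1%E /\
  cvg_in_dist P P' (fun t => cst t^-1 \* countR (N t)) L.
Arguments D_averages_in_time {d d' T T' R} P P' N L.

(* Main.v *)
(** Truncate at level [x]: [trunc x u] is [u] cut to the interval [0, x], and
    [tmoment X k x] is the [k]-th moment of [trunc x X]. Since
    [U x := tmoment X 2 x] increases by at least [3/4 W x] between [x / 2] and [x],
    where [W x := x^2 P(X > x)]
    is slowly varying, [W = o(U)]; hence [U] is slowly varying, and as
    [U x = int_0^x 2 u P(X > u) du] it is equivalent to [2 ltilde l]. Along [a t]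
    this gives [t U(a t) / a t ^ 2 --> 2], while [t P(X > a t)], the rescaled
    fourth moment [t tmoment X 4 (a t) / a t ^ 4] and [U (a t) / t] vanish, so
    Chebyshev's inequality for the observations truncated at [a t] controls
    [X_1^2 + ... + X_n^2] and [X_1 + ... + X_n] simultaneously, uniformly over
    sample sizes [n] of order [t]. Conditioning on [N t] shows that [t / a t ^ 2]
    times either statistic tends to [2 / mu_1] in probability, and the first two
    limits in distribution follow by a Slutsky argument for products. *)

Require Import Defs.
From mathcomp Require Import all_boot all_order all_algebra finmap.
From mathcomp Require Import all_classical all_reals all_analysis.
From mathcomp Require Import measurable_realfun.
From mathcomp Require Import ring lra.

Import Order.TTheory GRing.Theory Num.Theory.
Import numFieldNormedType.Exports.

Local Open Scope classical_set_scope.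
Local Open Scope ring_scope.

Set Implicit Arguments.
Unset Strict Implicit.
Unset Printing Implicit Defensive.

(** * Distribution functions and products of random variables *)

(** The squares have infinite mean, so Chebyshev cannot be applied to them directly. Capping at
    [a t] repairs this and costs at most [n P(X > a t)] in probability, which vanishes because W =
    o(U). That negligibility comes from adding up many dyadic increments of U, each of them at least
    a fixed multiple of the same [W x]. The 2 in the limit is the factor of the derivative 2 u of
    u^2. The infinite second moment does two things besides making U ultimately positive: it absorbs
    the constant by which U and 2 [ltilde l] may differ on a bounded interval, and it gives
    [t / a t ^ 2 --> 0], so that the sample mean drops out of the dispersion and both statistics
    share one limit. Since the limit in probability is the same for every sample size between
    [dlt * t] and [K * t], the counting process enters there only through tightness of N(t)/t, away
    from 0 and from infinity. The variable Lambda comes back as the limit of the factor N(t)/t, and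
    no joint law with the observations has to be studied. *)

Definition prob {d} {T : measurableType d} {R : realType} (P : probability T R)
  (A : set T) : R := fine (P A).

Section prob_lemmas.
Context d (T : measurableType d) (R : realType) (P : probability T R).

Lemma probE (A : set T) : measurable A -> P A = (prob P A)%:E.
Proof. by move=> mA; rewrite /prob fineK// fin_num_measure. Qed.

Lemma prob_ge0 (A : set T) : 0 <= prob P A.
Proof. exact/fine_ge0/measure_ge0. Qed.

Lemma prob_le1 (A : set T) : measurable A -> prob P A <= 1.
Proof. by move=> mA; rewrite -lee_fin -probE// probability_le1. Qed.

Lemma le_prob (A B : set T) : measurable A -> measurable B ->
  A `<=` B -> prob P A <= prob P B.
Proof. by move=> mA mB AB; rewrite -lee_fin -!probE// le_measure// inE. Qed.

Lemma le_probU (A B C : set T) :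
  measurable A -> measurable B -> measurable C ->
  A `<=` B `|` C -> prob P A <= prob P B + prob P C.
Proof.
move=> mA mB mC ABC; rewrite -lee_fin EFinD -!probE//.
apply: (le_trans (le_measure P _ _ ABC)); rewrite ?inE//; first exact: measurableU.
exact: measureU2.
Qed.

End prob_lemmas.

Section real_cdf.
Context d (T : measurableType d) (R : realType) (P : probability T R).
Implicit Types (X : {RV P >-> R}) (x y e : R).

Lemma measurable_le_RV X x : measurable [set w | X w <= x].
Proof.
rewrite (_ : [set w | _] = X @^-1` `]-oo, x]); first exact: measurable_funPTI.
by apply/seteqP; split=> w /=; rewrite in_itv.
Qed.

Lemma fine_cdfE X x : fine (cdf X x) = prob P [set w | X w <= x].
Proof.
by rewrite /cdf /distribution /pushforward /prob; congr (fine (P _)).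
Qed.

Lemma cdfE X x : cdf X x = (fine (cdf X x))%:E.
Proof. by rewrite fineK// fin_num_measure. Qed.

Lemma le_fine_cdf X x y : x <= y -> fine (cdf X x) <= fine (cdf X y).
Proof. by move=> xy; rewrite -lee_fin -!cdfE cdf_nondecreasing. Qed.

(** Monotonicity extends the bound given by right continuity to the whole half-line below
    [x + r]. *)
Lemma fine_cdf_right X x (e : R) : 0 < e -> exists2 r, 0 < r &
  forall y, y < x + r -> fine (cdf X y) < fine (cdf X x) + e.
Proof.
move=> e0; have := @cdf_right_continuous _ _ _ P X x; rewrite [in X in _ --> X -> _]cdfE.
move=> /fine_cvgP[_] /cvgrPdist_lt /(_ _ e0).
rewrite near_withinE => -[r /= r0 H]; exists (r / 2); first by rewrite divr_gt0.
move=> y yx; have [xy|yx'] := ltP x y; last first.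
  by apply: le_lt_trans (le_fine_cdf X yx') _; rewrite ltrDl.
have /(_ _ xy)/= := H y; rewrite /ball_ /= distrC gtr0_norm ?subr_gt0//.
move=> /(_ ltac:(lra)); rewrite ltr_norml => /andP[+ _]; lra.
Qed.

(** The events X <= x - 1/(n+1) increase to X < x, which carries the whole mass of X <= x when x is
    not an atom. *)
Lemma cdf_left_mass X x (e : R) : 0 < e -> prob P [set w | X w = x] = 0 ->
  exists2 r, 0 < r & forall y, x - r < y -> fine (cdf X x) - e < fine (cdf X y).
Proof.
move=> e0 X0.
pose F n := [set w | X w <= x - n.+1%:R^-1].
have mlt : measurable [set w | X w < x].
  rewrite (_ : [set w | _] = X @^-1` `]-oo, x[); first exact: measurable_funPTI.
  by apply/seteqP; split=> w /=; rewrite in_itv.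
have UF : \bigcup_n F n = [set w | X w < x].
  apply/seteqP; split=> [w [n _]|w] /= h.
    by apply: le_lt_trans h _; rewrite ltrBlDr ltrDl invr_gt0.
  have [n hn] := ltr_add_invr h; exists n => //=.
  by rewrite /F/= lerBrDr ltW.
have cvF : (P \o F) @ \oo --> P (\bigcup_n F n).
  apply: nondecreasing_cvg_mu => //.
  - by move=> n; exact: measurable_le_RV.
  - by rewrite UF.
  - move=> n m nm; apply/subsetPset => w; rewrite /F /= => /le_trans; apply.
    by rewrite lerD2l lerN2 lef_pV2 ?posrE// ler_nat.
move: cvF; rewrite UF (probE P mlt) => /fine_cvgP[_] /cvgrPdist_lt /(_ _ e0) [n _].
move=> /(_ n (leqnn n)) /=; rewrite -/(prob P (F n)) => h.
exists n.+1%:R^-1 => // y xy.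
have h1 : fine (cdf X x) <= prob P [set w | X w < x] + 0.
  rewrite -X0 fine_cdfE; apply: le_probU => //.
  - exact: measurable_le_RV.
  - rewrite (_ : [set w | _] = X @^-1` [set x]) //; exact: measurable_funPTI.
  - by move=> w /=; rewrite le_eqVlt => /predU1P[->|]; [right|left].
have h2 : prob P (F n) <= fine (cdf X y).
  rewrite fine_cdfE; apply: le_prob; try exact: measurable_le_RV.
  by move=> w; rewrite /F/= => /le_trans; apply; exact: ltW.
move: h; rewrite ltr_norml => /andP[_]; lra.
Qed.

(** Every distribution function is right continuous, so control from the left is all that remains to
    be supplied. *)
Lemma continuous_cdfP X x :
  (forall e, 0 < e -> exists2 r, 0 < r &
     forall y, x - r < y -> fine (cdf X x) - e < fine (cdf X y)) ->
  {for x, continuous (cdf X)}.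
Proof.
move=> H; rewrite /prop_for /continuous_at [X in _ --> X]cdfE.
apply/fine_cvgP; split; first by near=> y; rewrite fin_num_measure.
apply/cvgrPdist_lt => e e0.
have [r r0 Hr] := H _ e0; have [s s0 Hs] := fine_cdf_right X x e0.
near=> y => /=.
have xy : `|x - y| < Num.min r s by near: y; apply: cvgr_dist_lt; rewrite ?lt_min ?r0.
move: xy; rewrite lt_min ltr_norml => /andP[/andP[_ h1]].
rewrite ltr_norml => /andP[h2 _].
have := Hr y ltac:(lra); have := Hs y ltac:(lra).
by rewrite ltr_norml => *; apply/andP; split; lra.
Unshelve. all: end_near. Qed.

Lemma continuous_cdf_left X x (e : R) : 0 < e -> {for x, continuous (cdf X)} ->
  exists2 r, 0 < r & forall y, x - r < y -> fine (cdf X x) - e < fine (cdf X y).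
Proof.
move=> e0; rewrite /prop_for /continuous_at [X in _ --> X -> _]cdfE.
move=> /fine_cvgP[_] /cvgrPdist_lt /(_ _ e0) [r /= r0 H].
exists r => // y xy; have [yx|xy'] := ltP y x; last first.
  by apply: lt_le_trans (le_fine_cdf X xy'); rewrite ltrBlDr ltrDl.
have /= := H y; rewrite /ball_/= gtr0_norm ?subr_gt0// => /(_ ltac:(lra)).
by rewrite ltr_norml => /andP[_]; lra.
Qed.

(** Otherwise every point of ]u, v[ would be an atom; there are countably many atoms, and a
    countable set has Lebesgue measure 0. *)
Lemma exists_continuity_point X u v : u < v ->
  exists2 z, u < z < v & {for z, continuous (cdf X)}.
Proof.
move=> uv; apply: contrapT => H.
have sub : `]u, v[%classic `<=` [set r | 0 < pmf X r].
  move=> z /=; rewrite in_itv/= => uzv.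
  rewrite lt_neqAle pmf_ge0 andbT; apply/eqP => z0.
  apply: H; exists z => //; apply: continuous_cdfP => e e0.
  by apply: cdf_left_mass.
have /countable_lebesgue_measure0 : countable `]u, v[%classic.
  by apply: sub_countable (pmf_gt0_countable X); exact: subset_card_le.
rewrite lebesgue_measure_itv/= lte_fin uv => /eqP.
by rewrite -EFinD eqe subr_eq0 => /eqP vu; rewrite vu ltxx in uv.
Qed.

Lemma fine_cdf0 X : P [set w | 0 < X w] = 1%E -> fine (cdf X 0) = 0.
Proof.
have mX : measurable [set w | 0 < X w].
  rewrite (_ : [set w | _] = X @^-1` `]0, +oo[); first exact: measurable_funPTI.
  by apply/seteqP; split=> w /=; rewrite in_itv/= andbT.
move=> X0; rewrite fine_cdfE /prob (_ : [set w | _] = ~` [set w | 0 < X w]).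
  by rewrite probability_setC// X0 subee.
by apply/seteqP; split=> w /=; rewrite leNgt => /negP.
Qed.

End real_cdf.

Section slutsky.
Context d d' (T : measurableType d) (T' : measurableType d') (R : realType).
Context (P : probability T R) (P' : probability T' R).

Definition cvg_in_probability (Q : R -> {RV P >-> R}) (c : R) :=
  forall e h : R, 0 < e -> 0 < h ->
    \forall t \near +oo, prob P [set w | e < `|Q t w - c|] <= h.

Lemma measurable_dist_RV (X : {RV P >-> R}) c e :
  measurable [set w | e < `|X w - c|].
Proof.
rewrite (_ : [set w | _] = (fun w => `|X w - c|) @^-1` `]e, +oo[); last first.
  by apply/seteqP; split=> w /=; rewrite in_itv/= andbT.
rewrite -[X in measurable X]setTI.
have : measurable_fun setT (fun w => `|X w - c|).
  by apply: measurableT_comp => //; exact: measurable_funB.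
by apply=> //; exact: measurable_itv.
Qed.

(* Both factors being nonnegative up to a small event, [Y t <= x] is squeezed
   between events [A t <= z] for continuity points z close to [x / c]. *)
Lemma cvg_in_dist_mul (A Q Y : R -> {RV P >-> R}) (L Z : {RV P' >-> R}) c :
  0 < c -> P' [set w | 0 < L w] = 1%E ->
  (\forall t \near +oo, forall w, 0 <= A t w) ->
  (\forall t \near +oo, forall w, Y t w = A t w * Q t w) ->
  (forall w, Z w = c * L w) ->
  cvg_in_dist P P' A L -> cvg_in_probability Q c -> cvg_in_dist P P' Y Z.
Proof.
move=> c0 L0 A0 YE ZE AL Qc x xZ.
have ZL u : fine (cdf Z u) = fine (cdf L (u / c)).
  rewrite !fine_cdfE; congr prob; apply/seteqP; split=> w /=;
  by rewrite ZE ler_pdivlMr// mulrC.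
have FL0 := fine_cdf0 L0.
(* Replacing [x / c] by its maximum with 0 makes the upper point z positive, and it changes nothing
   since the distribution function of [L] vanishes on the negative half-line and at 0. *)
have FLm : fine (cdf L (Num.max (x / c) 0)) = fine (cdf L (x / c)).
  case: (leP (x / c) 0) => // h; apply/eqP; rewrite FL0 eq_le fine_ge0//=.
  by rewrite -FL0 le_fine_cdf.
rewrite [X in _ --> X]cdfE; apply/fine_cvgP; split.
  by near=> t; rewrite fin_num_measure.
apply/cvgrPdist_le => e e0.
have e4 : 0 < e / 4 by rewrite divr_gt0.
have [r r0 Hr] := fine_cdf_right L (Num.max (x / c) 0) e4.
have [z /andP[mz zr] cz] : exists2 z,
    Num.max (x / c) 0 < z < Num.max (x / c) 0 + r & {for z, continuous (cdf L)}.
  by apply: exists_continuity_point; rewrite ltrDl.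
have {Hr} := Hr z zr; rewrite FLm => Hz.
move: mz; rewrite gt_max => /andP[xz z0].
have xcz : x < z * c by rewrite -ltr_pdivrMr.
(* This gives [z * (c - e1) > x], so that [A t > z] and [Q t] within [e1] of c force [Y t > x]. The
   minimum with c keeps the factor [c - e1] nonnegative. *)
pose e1 := Num.min c ((z * c - x) / (2 * z)).
have e10 : 0 < e1 by rewrite lt_min c0 divr_gt0 ?subr_gt0// mulr_gt0.
have [s s0 Hs] := continuous_cdf_left e4 xZ.
have [y /andP[sy yx] cy] : exists2 z,
    (x - s) / c < z < x / c & {for z, continuous (cdf L)}.
  by apply: exists_continuity_point; rewrite ltr_pM2r ?invr_gt0// ltrBlDr ltrDl.
have Hy : fine (cdf Z x) - e / 4 < fine (cdf L y).
  have := Hs (y * c); rewrite (ZL (y * c)) mulfK ?gt_eqF//; apply.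
  by rewrite -ltr_pdivrMr.
have ycx : y * c < x by rewrite -ltr_pdivlMr.
(* For y >= 0 this gives [y * (c + e2) <= x]. The absolute value covers y < 0, where the event
   [A t <= y] is empty because [A t] is nonnegative. *)
pose e2 := (x - y * c) / (1 + `|y|).
have y1 : 0 < 1 + `|y| by rewrite ltr_pwDl.
have e20 : 0 < e2 by rewrite divr_gt0// subr_gt0.
have := AL z cz; rewrite [in X in X -> _](cdfE L) => /fine_cvgP[_] /cvgrPdist_lt/(_ _ e4) Az.
have := AL y cy; rewrite [in X in X -> _](cdfE L) => /fine_cvgP[_] /cvgrPdist_lt/(_ _ e4) Ay.
have Q1 := Qc _ _ e10 e4; have Q2 := Qc _ _ e20 e4.
near=> t => /=.
have At0 : forall w, 0 <= A t w by near: t.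
have YEt : forall w, Y t w = A t w * Q t w by near: t.
have ub : fine (cdf (Y t) x) <= fine (cdf (A t) z) + e / 4.
  rewrite !fine_cdfE; apply: le_trans
    (_ : _ <= prob P [set w | A t w <= z] + prob P [set w | e1 < `|Q t w - c|]) _.
    apply: le_probU; [exact: measurable_le_RV..|exact: measurable_dist_RV|].
    move=> w /= Yx; have [Az'|Az'] := leP (A t w) z; [by left|right].
    rewrite ltNge; apply/negP; rewrite ler_norml => /andP[h _].
    move: Yx; apply/negP; rewrite -ltNge YEt.
    have ce1 : 0 <= c - e1 by rewrite subr_ge0 ge_min lexx.
    apply: lt_le_trans (_ : z * (c - e1) <= _).
      have : e1 * (2 * z) <= z * c - x.
        by rewrite -ler_pdivlMr ?mulr_gt0// ge_min lexx orbT.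
      nra.
    apply: ler_pM => //; [exact: ltW|exact: ltW|lra].
  by rewrite lerD2l; near: t.
have lb : fine (cdf (A t) y) <= fine (cdf (Y t) x) + e / 4.
  rewrite !fine_cdfE; apply: le_trans
    (_ : _ <= prob P [set w | Y t w <= x] + prob P [set w | e2 < `|Q t w - c|]) _.
    apply: le_probU; [exact: measurable_le_RV..|exact: measurable_dist_RV|].
    move=> w /= Ayw; have [h|h] := ltP e2 `|Q t w - c|; [by right|left].
    move: h; rewrite ler_norml YEt => /andP[_ h].
    have y0 : 0 <= y by exact: le_trans Ayw.
    have : e2 * (1 + y) = x - y * c.
      by rewrite /e2 ger0_norm// divfK// gt_eqF// ltr_pwDl.
    have := At0 w; move=> *.
    apply: le_trans (_ : y * (c + e2) <= _); last by nra.
    apply: le_trans (_ : A t w * (c + e2) <= _).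
      by apply: ler_wpM2l => //; lra.
    by apply: ler_wpM2r => //; lra.
  by rewrite lerD2l; near: t.
have Azt : `|fine (cdf L z) - fine (cdf (A t) z)| < e / 4 by near: t.
have Ayt : `|fine (cdf L y) - fine (cdf (A t) y)| < e / 4 by near: t.
move: Azt Ayt (ZL x) ub lb Hz Hy; rewrite !ltr_norml; clear.
by move=> /andP[? ?] /andP[? ?] *; rewrite ler_norml; apply/andP; split; lra.
Unshelve. all: end_near. Qed.

Lemma cvg_in_dist_cst (X : {RV P' >-> R}) (Y : R -> {RV P >-> R}) a :
  (forall t w, Y t w = a) -> (forall w, X w = a) -> cvg_in_dist P P' Y X.
Proof.
move=> Ya Xa x _; apply: cvg_near_cst; near=> t.
rewrite [LHS]cdfE [RHS]cdfE !fine_cdfE; congr (_%:E).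
have [ax|ax] := leP a x.
  have -> : [set w | Y t w <= x] = setT by apply/seteqP; split=> w //=; rewrite Ya.
  have -> : [set w | X w <= x] = setT by apply/seteqP; split=> w //=; rewrite Xa.
  by rewrite /prob !probability_setT.
have -> : [set w | Y t w <= x] = set0.
  by apply/seteqP; split=> w //=; rewrite Ya leNgt ax.
have -> : [set w | X w <= x] = set0.
  by apply/seteqP; split=> w //=; rewrite Xa leNgt ax.
by rewrite /prob !measure0.
Unshelve. all: end_near. Qed.

End slutsky.

(** * Truncated moments *)

Section bounded_expectation.
Context d (T : measurableType d) (R : realType) (P : probability T R).
Implicit Types (f g : T -> R) (c : R).

(** Bounded measurable functions are integrable against a probability, so real-valued expectations
    are linear and monotone on this class, which is closed under sums and products. *)
Definition bounded_measurable f :=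
  measurable_fun setT f /\ exists M : R, forall w, `|f w| <= M.

Lemma bounded_measurable_integrable f :
  bounded_measurable f -> P.-integrable setT (EFin \o f).
Proof.
move=> [mf [M fM]]; apply: measurable_bounded_integrable => //.
  by rewrite (le_lt_trans (probability_le1 P measurableT))// ltry.
by exists M; split; [exact: num_real|move=> x Mx w _; exact: le_trans (fM w) (ltW Mx)].
Qed.

Lemma bounded_measurable_cst c : bounded_measurable (cst c).
Proof. by split => //; exists `|c|. Qed.

Lemma bounded_measurableD f g : bounded_measurable f -> bounded_measurable g ->
  bounded_measurable (fun w => f w + g w).
Proof.
move=> [mf [M fM]] [mg [K gK]]; split; first exact: measurable_funD.
by exists (M + K) => w; rewrite (le_trans (ler_normD _ _))// lerD.
Qed.

Lemma bounded_measurableM f g : bounded_measurable f -> bounded_measurable g ->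
  bounded_measurable (fun w => f w * g w).
Proof.
move=> [mf [M fM]] [mg [K gK]]; split; first exact: measurable_funM.
by exists (M * K) => w; rewrite normrM ler_pM.
Qed.

Lemma bounded_measurable_indic (A : set T) :
  measurable A -> bounded_measurable (\1_A : T -> R).
Proof.
move=> mA; split; first exact: measurable_indic.
by exists 1 => w; rewrite indicE; case: (_ \in _); rewrite ?normr0// normr1.
Qed.

Lemma bounded_measurable_sum (f : nat -> T -> R) n :
  (forall i, bounded_measurable (f i)) ->
  bounded_measurable (fun w => \sum_(i < n) f i w).
Proof.
move=> bf; elim: n => [|n IH].
  by under eq_fun do rewrite big_ord0; exact: bounded_measurable_cst.
by under eq_fun do rewrite big_ord_recr; exact: bounded_measurableD.
Qed.

Lemma bounded_expectationD f g : bounded_measurable f -> bounded_measurable g ->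
  \int[P]_w (f w + g w) = \int[P]_w f w + \int[P]_w g w.
Proof. by move=> bf bg; rewrite RintegralD//; exact: bounded_measurable_integrable. Qed.

Lemma bounded_expectationZ c f : bounded_measurable f ->
  \int[P]_w (c * f w) = c * \int[P]_w f w.
Proof. by move=> bf; rewrite RintegralZl//; exact: bounded_measurable_integrable. Qed.

Lemma bounded_expectation_cst c : \int[P]_w c = c.
Proof. rewrite Rintegral_cst// -[RHS]mulr1; congr (_ * _).
by rewrite (_ : 1 = fine 1%E)//; congr fine; exact: probability_setT. Qed.

Lemma bounded_expectation_indic (A : set T) :
  measurable A -> \int[P]_w \1_A w = prob P A.
Proof. by move=> mA; rewrite /Rintegral integral_indic// setIT. Qed.

Lemma le_bounded_expectation f g : bounded_measurable f -> bounded_measurable g ->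
  (forall w, f w <= g w) -> \int[P]_w f w <= \int[P]_w g w.
Proof.
by move=> bf bg fg; apply: le_Rintegral => //; exact: bounded_measurable_integrable.
Qed.

Lemma bounded_expectation_ge0 f : (forall w, 0 <= f w) -> 0 <= \int[P]_w f w.
Proof. by move=> f0; apply: Rintegral_ge0 => w _. Qed.

Lemma EFin_bounded_expectation f : bounded_measurable f ->
  ((\int[P]_w f w)%:E = \int[P]_w (f w)%:E)%E.
Proof.
by move=> bf; rewrite fineK// integrable_fin_num//; exact: bounded_measurable_integrable.
Qed.

End bounded_expectation.

Section truncation.
Context {R : realType}.
Implicit Types a b x y u : R.

(** Large values are capped rather than set to 0: the truncated moments are then monotone in the
    level and the layer-cake formula has no boundary term. The maximum with 0 is there because [X]
    is positive only almost surely. *)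
Definition trunc a u : R := Num.min (Num.max u 0) a.

Lemma measurable_trunc a : measurable_fun setT (trunc a).
Proof. by apply: measurable_minr => //; exact: measurable_maxr. Qed.

Lemma trunc_ge0 a u : 0 <= a -> 0 <= trunc a u.
Proof. by move=> a0; rewrite le_min a0 le_max lexx orbT. Qed.

Lemma trunc_le a u : trunc a u <= a.
Proof. by rewrite ge_min lexx orbT. Qed.

Lemma trunc_id a u : 0 <= u <= a -> trunc a u = u.
Proof. by move=> /andP[u0 ua]; rewrite /trunc max_l// min_l. Qed.

Variant trunc_spec a u : R -> bool -> Type :=
| TruncNeg of u <= 0 & 0 <= a : trunc_spec a u 0 false
| TruncIn of 0 < u & u <= a : trunc_spec a u u false
| TruncOver of a < u & 0 <= a : trunc_spec a u a true.

Lemma truncP a u : 0 <= a -> trunc_spec a u (trunc a u) (a < u).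
Proof.
move=> a0; rewrite /trunc; have [u0|u0] := leP u 0.
  by rewrite min_l// ltNge (le_trans u0 a0)/=; constructor.
by have [ua|ua] := leP u a; constructor.
Qed.

Lemma trunc_sqr_lower x y u : 0 <= x -> x <= y ->
  (y ^+ 2 - x ^+ 2) * (y < u)%R%:R <= trunc y u ^+ 2 - trunc x u ^+ 2.
Proof.
move=> x0 xy; have y0 : 0 <= y by exact: le_trans xy.
case: (truncP u x0) => [u0 _|u0 ux|xu _]; case: (truncP u y0) => *;
  rewrite /= ?mulr0 ?mulr1; nra.
Qed.

Lemma trunc_sqr_upper x y u : 0 <= x -> x <= y ->
  trunc y u ^+ 2 - trunc x u ^+ 2 <= (y ^+ 2 - x ^+ 2) * (x < u)%R%:R.
Proof.
move=> x0 xy; have y0 : 0 <= y by exact: le_trans xy.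
case: (truncP u x0) => [u0 _|u0 ux|xu _]; case: (truncP u y0) => *;
  rewrite /= ?mulr0 ?mulr1; nra.
Qed.

Lemma trunc_upper x y u : 0 <= x -> x <= y ->
  trunc y u - trunc x u <= (y - x) * (x < u)%R%:R.
Proof.
move=> x0 xy; have y0 : 0 <= y by exact: le_trans xy.
case: (truncP u x0) => [u0 _|u0 ux|xu _]; case: (truncP u y0) => *;
  rewrite /= ?mulr0 ?mulr1; lra.
Qed.

Lemma trunc_homo x y u : 0 <= x -> x <= y -> trunc x u <= trunc y u.
Proof.
move=> x0 xy; have y0 : 0 <= y by exact: le_trans xy.
by case: (truncP u x0) => [u0 _|u0 ux|xu _]; case: (truncP u y0) => *; lra.
Qed.

Lemma trunc_lower x u : 0 <= x -> x * (x < u)%R%:R <= trunc x u.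
Proof. by move=> x0; case: (truncP u x0) => *; rewrite /= ?mulr0 ?mulr1; lra. Qed.

(** Below [c * a], two of the four factors are at most [c * a]; above it, the crude bound [a ^+ 4]
    is paid only on a tail event. A small c later makes the first term small. *)
Lemma trunc4_le c a u : 0 <= c <= 1 -> 0 <= a ->
  trunc a u ^+ 4 <= (c * a) ^+ 2 * trunc a u ^+ 2 + a ^+ 4 * (c * a < u)%R%:R.
Proof.
move=> /andP[c0 c1] a0; have ca0 : 0 <= c * a by exact: mulr_ge0.
have t0 := trunc_ge0 u a0.
have t1 := trunc_le a u.
case: (ltP (c * a) u) => [cau|uca].
  rewrite mulr1; apply: ler_wpDl; first by rewrite mulr_ge0// sqr_ge0.
  by rewrite lerXn2r// nnegrE.
rewrite mulr0 addr0 (exprD _ 2 2) ler_wpM2r ?sqr_ge0// lerXn2r ?nnegrE//.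
by move: t0 t1; case: (truncP u a0) => *; lra.
Qed.

(** A difference of squares whose factor [trunc x u + trunc b u] is at most [2 * x]. *)
Lemma trunc_sqr_le b x u : 0 <= b -> b <= x ->
  trunc x u ^+ 2 <= b ^+ 2 + 2 * x * (trunc x u - trunc b u).
Proof.
move=> b0 bx; have x0 : 0 <= x by exact: le_trans bx.
by case: (truncP u b0) => [u0 _|u0 ux|xu _]; case: (truncP u x0) => *; nra.
Qed.

End truncation.

Section truncated_moments.
Context d (T : measurableType d) (R : realType) (P : probability T R).
Variable X : {RV P >-> R}.
Implicit Types a b c x y : R.

Definition tail x := prob P [set w | x < X w].

Definition tmoment k a := \int[P]_w (trunc a (X w) ^+ k).

Lemma measurable_gt_RV x : measurable [set w | x < X w].
Proof.
rewrite (_ : [set w | _] = X @^-1` `]x, +oo[); first exact: measurable_funPTI.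
by apply/seteqP; split=> w /=; rewrite in_itv/= andbT.
Qed.

Lemma tailE x : tail x = 1 - fine (cdf X x).
Proof.
rewrite fine_cdfE /tail /prob (_ : [set w | x < X w] = ~` [set w | X w <= x]).
  rewrite probability_setC; last exact: measurable_le_RV.
  by rewrite fineB ?fin_num_measure//; exact: measurable_le_RV.
by apply/seteqP; split=> w /=; [rewrite ltNge => /negP|rewrite ltNge => /negP].
Qed.

Lemma tail_ge0 x : 0 <= tail x. Proof. exact: prob_ge0. Qed.

Lemma bounded_measurable_trunc k a : 0 <= a ->
  bounded_measurable (fun w => trunc a (X w) ^+ k).
Proof.
move=> a0; split.
  by apply: measurable_funX; apply: measurableT_comp => //; exact: measurable_trunc.
exists (a ^+ k) => w; rewrite ger0_norm ?exprn_ge0 ?trunc_ge0//.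
by rewrite lerXn2r ?nnegrE ?trunc_ge0 ?trunc_le.
Qed.

Lemma indic_tail x : \1_[set w | x < X w] = (fun w => (x < X w)%R%:R) :> (T -> R).
Proof.
apply/funext => w; rewrite indicE (_ : (w \in _) = (x < X w))//.
by apply/idP/idP => [/set_mem|/mem_set].
Qed.

Lemma bounded_measurable_tail x : bounded_measurable (fun w => (x < X w)%R%:R : R).
Proof. by rewrite -indic_tail; apply: bounded_measurable_indic (measurable_gt_RV x). Qed.

Lemma expectation_tail x : \int[P]_w (x < X w)%R%:R = tail x.
Proof.
by rewrite /tail -bounded_expectation_indic ?indic_tail//; exact: measurable_gt_RV.
Qed.

Lemma tmoment_ge0 k a : 0 <= a -> 0 <= tmoment k a.
Proof.
by move=> a0; apply: bounded_expectation_ge0 => w; rewrite exprn_ge0// trunc_ge0.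
Qed.

(** Integrates the pointwise bounds on truncations. The sign of c is free, so upper bounds are
    obtained by moving the tail term to the other side. *)
Lemma le_expectation_tail (f g : T -> R) c x :
  bounded_measurable f -> bounded_measurable g ->
  (forall w, f w + c * (x < X w)%R%:R <= g w) ->
  \int[P]_w f w + c * tail x <= \int[P]_w g w.
Proof.
move=> bf bg fg; rewrite -expectation_tail -bounded_expectationZ; last first.
  exact: bounded_measurable_tail.
have bt : bounded_measurable (fun w => c * (x < X w)%R%:R).
  apply: bounded_measurableM; [exact: bounded_measurable_cst|].
  exact: bounded_measurable_tail.
rewrite -bounded_expectationD//.
by apply: le_bounded_expectation => //; exact: bounded_measurableD.
Qed.

Lemma tmoment2_lower x y : 0 <= x -> x <= y ->
  (y ^+ 2 - x ^+ 2) * tail y <= tmoment 2 y - tmoment 2 x.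
Proof.
move=> x0 xy; rewrite lerBrDl; apply: le_expectation_tail.
- exact: bounded_measurable_trunc.
- by apply: bounded_measurable_trunc; exact: le_trans xy.
- by move=> w; rewrite -lerBrDl; exact: trunc_sqr_lower.
Qed.

Lemma tmoment2_upper x y : 0 <= x -> x <= y ->
  tmoment 2 y - tmoment 2 x <= (y ^+ 2 - x ^+ 2) * tail x.
Proof.
move=> x0 xy; suff : tmoment 2 y + - (y ^+ 2 - x ^+ 2) * tail x <= tmoment 2 x.
  by lra.
apply: le_expectation_tail.
- by apply: bounded_measurable_trunc; exact: le_trans xy.
- exact: bounded_measurable_trunc.
- by move=> w; have := trunc_sqr_upper (X w) x0 xy; lra.
Qed.

Lemma tmoment1_upper x y : 0 <= x -> x <= y ->
  tmoment 1 y - tmoment 1 x <= (y - x) * tail x.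
Proof.
move=> x0 xy; suff : tmoment 1 y + - (y - x) * tail x <= tmoment 1 x by lra.
apply: le_expectation_tail.
- by apply: bounded_measurable_trunc; exact: le_trans xy.
- exact: bounded_measurable_trunc.
- by move=> w; have := trunc_upper (X w) x0 xy; rewrite !expr1; lra.
Qed.

Lemma tmoment1_lower x : 0 <= x -> x * tail x <= tmoment 1 x.
Proof.
move=> x0; have := @le_expectation_tail (cst 0) (fun w => trunc x (X w) ^+ 1) x x.
rewrite bounded_expectation_cst add0r; apply.
- exact: bounded_measurable_cst.
- exact: bounded_measurable_trunc.
- by move=> w; rewrite add0r expr1 trunc_lower.
Qed.

Lemma le_tmoment k x y : 0 <= x -> x <= y -> tmoment k x <= tmoment k y.
Proof.
move=> x0 xy; have y0 := le_trans x0 xy; apply: le_bounded_expectation.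
- exact: bounded_measurable_trunc.
- exact: bounded_measurable_trunc.
- by move=> w; rewrite lerXn2r ?nnegrE ?trunc_ge0// trunc_homo.
Qed.

Lemma tmoment4_le c a : 0 <= c <= 1 -> 0 <= a ->
  tmoment 4 a <= (c * a) ^+ 2 * tmoment 2 a + a ^+ 4 * tail (c * a).
Proof.
move=> c01 a0; have b2 := bounded_measurable_trunc 2 a0.
suff : tmoment 4 a + - a ^+ 4 * tail (c * a) <=
    \int[P]_w ((c * a) ^+ 2 * trunc a (X w) ^+ 2).
  by rewrite bounded_expectationZ// -/(tmoment 2 a); lra.
apply: le_expectation_tail.
- exact: bounded_measurable_trunc.
- by apply: bounded_measurableM => //; exact: bounded_measurable_cst.
- by move=> w; have := trunc4_le (X w) c01 a0; lra.
Qed.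

Lemma tmoment2_le b x : 0 <= b -> b <= x ->
  tmoment 2 x <= b ^+ 2 + 2 * x * (tmoment 1 x - tmoment 1 b).
Proof.
move=> b0 bx; have x0 := le_trans b0 bx.
have b1x := bounded_measurable_trunc 1 x0.
have b1b := bounded_measurable_trunc 1 b0.
have bN : bounded_measurable (fun w => - 1 * trunc b (X w) ^+ 1).
  by apply: bounded_measurableM => //; exact: bounded_measurable_cst.
have bB := bounded_measurableD b1x bN.
have bZ : bounded_measurable
    (fun w => 2 * x * (trunc x (X w) ^+ 1 + - 1 * trunc b (X w) ^+ 1)).
  by apply: bounded_measurableM => //; exact: bounded_measurable_cst.
rewrite (_ : _ - _ = tmoment 1 x + - 1 * tmoment 1 b); last by rewrite mulN1r.
rewrite -bounded_expectationZ// -bounded_expectationD// -bounded_expectationZ//.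
rewrite -[X in X + _](bounded_expectation_cst P) -bounded_expectationD//; last first.
  exact: bounded_measurable_cst.
apply: le_bounded_expectation => //.
- exact: bounded_measurable_trunc.
- by apply: bounded_measurableD => //; exact: bounded_measurable_cst.
- by move=> w; rewrite !expr1 mulN1r; exact: trunc_sqr_le.
Qed.

(** Monotone convergence, after replacing [X] by its positive part almost everywhere. The limit
    lives in the extended reals so as to serve both the finite mean (k = 1) and the infinite second
    moment (k = 2). *)
Lemma cvg_tmoment k : P [set w | 0 < X w] = 1%E ->
  (tmoment k n%:R)%:E @[n --> \oo] --> 'E_P[(X : T -> R) ^+ k]%E.
Proof.
move=> X0.
have -> : 'E_P[(X : T -> R) ^+ k]%E = (\int[P]_w ((Num.max (X w) 0) ^+ k)%:E)%E.
  rewrite unlock; apply: ae_eq_integral => //.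
  - apply/measurable_EFinP.
    rewrite (_ : (X : T -> R) ^+ k = fun w => X w ^+ k); first exact: measurable_funX.
    by apply/funext => w; elim: k => [|k IH]//; rewrite !exprS -IH.
  - by apply/measurable_EFinP; apply: measurable_funX; exact: measurable_maxr.
  - have mC := measurableC (measurable_gt_RV 0).
    have PC : P (~` [set w | 0 < X w]) = 0%E.
      by rewrite probability_setC ?X0 ?subee//; exact: measurable_gt_RV.
    exists (~` [set w | 0 < X w]); split => //.
    apply: subsetC => w /= w0 _; rewrite max_l; last exact: ltW.
    by congr (_%:E); elim: k => [|k IH]//; rewrite !exprS -IH.
pose g n w := ((trunc n%:R (X w)) ^+ k)%:E.
have cvg_g w : g n w @[n --> \oo] --> ((Num.max (X w) 0) ^+ k)%:E.
  apply: cvg_near_cst; near=> n; rewrite /g /trunc min_l//.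
  by near: n; exact: nbhs_infty_ger.
have -> : (fun n => (tmoment k n%:R)%:E) = fun n => (\int[P]_w g n w)%E.
  apply/funext => n; rewrite EFin_bounded_expectation//.
  exact: bounded_measurable_trunc.
under eq_integral do rewrite -(cvg_lim _ (cvg_g _))//.
apply: cvg_monotone_convergence => //.
- move=> n; apply/measurable_EFinP.
  by have [] := bounded_measurable_trunc k (ler0n R n).
- by move=> n w _; rewrite lee_fin exprn_ge0// trunc_ge0.
- move=> w _ n m nm; rewrite lee_fin lerXn2r ?nnegrE ?trunc_ge0//.
  by rewrite trunc_homo// ler_nat.
Unshelve. all: end_near. Qed.

End truncated_moments.

(** * Infinite second moment with a slowly varying scaled tail *)

Section at_infinity.
Context {R : realType}.

Lemma near_pinftyZ (Q : R -> Prop) (c : R) : 0 < c ->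
  (\forall x \near +oo, Q x) -> \forall x \near +oo, Q (c * x).
Proof.
move=> c0 [M [_ MQ]]; exists (M / c); split; first exact: num_real.
by move=> x; rewrite ltr_pdivrMr// mulrC => /MQ.
Qed.

Lemma cvg_pinftyZ (f : R -> R) (c a : R) : 0 < c ->
  f x @[x --> +oo] --> a -> f (c * x) @[x --> +oo] --> a.
Proof. by move=> c0 fa A /fa; exact: near_pinftyZ. Qed.

Lemma near_eq_cvg_pinfty (f g : R -> R) (a : R) :
  f x @[x --> +oo] --> a -> (\forall x \near +oo, f x = g x) ->
  g x @[x --> +oo] --> a.
Proof. by move=> fa fg; apply: cvg_trans fa; exact: near_eq_cvg. Qed.

End at_infinity.

Section infinite_second_moment.
Context d (T : measurableType d) (R : realType) (P : probability T R).
Variables (X : {RV P >-> R}) (l : R -> R).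
Hypothesis X_pos : P [set w | 0 < X w] = 1%E.
Hypothesis X_pareto : pareto_type P X 2 l.

Implicit Types c x : R.
Local Notation U := (tmoment X 2).
Local Notation M := (tmoment X 1).

Definition scaled_tail (x : R) := x ^+ 2 * tail X x.
Local Notation W := scaled_tail.

Lemma scaled_tail_ge0 x : 0 <= W x.
Proof. by rewrite mulr_ge0 ?sqr_ge0 ?tail_ge0. Qed.

(** Lets W stand in for [l]: W is nonnegative everywhere and is tied to the truncated moments by
    exact inequalities, while [l] is controlled only asymptotically. *)
Lemma scaled_tail_equiv : W x / l x @[x --> +oo] --> (1 : R).
Proof.
have [_] := X_pareto; apply: cvg_trans; apply: near_eq_cvg; near=> x.
have x0 : 0 < x by near: x; exact: nbhs_pinfty_gt.
rewrite -tailE /W powRN -[2]/(2%:R) powR_mulrn ?ltW// invfM invrK.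
by rewrite mulrA (mulrC (tail X x)).
Unshelve. all: end_near. Qed.

Lemma scaled_tail_gt0 : \forall x \near +oo, 0 < W x.
Proof.
have [[_ l0 _] _] := X_pareto.
have h : \forall x \near +oo, 0 < W x / l x.
  by have /cvgr_gt := scaled_tail_equiv; apply.
near=> x.
have lx : 0 < l x by near: x.
have : 0 < W x / l x by near: x.
by rewrite pmulr_lgt0// invr_gt0.
Unshelve. all: end_near. Qed.

Lemma scaled_tail_slow c : 0 < c -> W (c * x) / W x @[x --> +oo] --> (1 : R).
Proof.
move=> c0; have [[_ l0 lc] _] := X_pareto.
have h1 := scaled_tail_equiv.
have h2 := cvg_pinftyZ c0 h1.
have h3 : (W (c * x) / l (c * x)) * (l (c * x) / l x) / (W x / l x) @[x --> +oo]
    --> (1 * 1 / 1 : R).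
  apply: cvgM; first by apply: cvgM => //; exact: lc.
  by apply: cvgV => //; exact: oner_neq0.
rewrite !mul1r invr1 in h3; apply: near_eq_cvg_pinfty h3 _; near=> x.
have lx : 0 < l x by near: x.
have lcx : 0 < l (c * x) by near: x; exact: (near_pinftyZ c0 l0).
have Wx : 0 < W x by near: x; exact: scaled_tail_gt0.
by field; rewrite !gt_eqF.
Unshelve. all: end_near. Qed.

(** Each halving of y loses at least [3 / 4 * W y]. Since K is fixed before x, slow variation gives
    [W y >= W x / 2] at all the levels y = x / 2^k with k < K, whence 3/8 for each step. *)
Lemma tmoment2_dyadic K :
  \forall x \near +oo, 3 / 8 * K%:R * W x <= U x - U (x / 2 ^+ K).
Proof.
elim: K => [|K IH].
  by near=> x; rewrite mulr0 mul0r expr0 divr1 subrr.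
have c0 : 0 < (2 ^+ K)^-1 :> R by rewrite invr_gt0 exprn_gt0.
have h : \forall x \near +oo, 2^-1 < W ((2 ^+ K)^-1 * x) / W x.
  have /cvgr_gt := scaled_tail_slow c0; apply.
  by rewrite invf_lt1// ltr1n.
near=> x.
have x0 : 0 < x by near: x; exact: nbhs_pinfty_gt.
have Wx : 0 < W x by near: x; exact: scaled_tail_gt0.
have IHx : 3 / 8 * K%:R * W x <= U x - U (x / 2 ^+ K) by near: x.
have : 2^-1 < W ((2 ^+ K)^-1 * x) / W x by near: x.
rewrite ltr_pdivlMr// mulrC (mulrC _ x) => hx.
set y := x / 2 ^+ K in IHx hx *.
have y0 : 0 < y by rewrite divr_gt0// exprn_gt0.
have -> : x / 2 ^+ K.+1 = y / 2 by rewrite exprSr invfM mulrA.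
have := @tmoment2_lower _ _ _ _ X (y / 2) y ltac:(lra) ltac:(lra).
rewrite -(natr1 K) => hy.
have {hy} : 3 / 4 * W y <= U y - U (y / 2).
  by apply: le_trans hy; rewrite /W mulrA; apply: ler_wpM2r; [exact: tail_ge0|nra].
by move: IHx hx; clear; lra.
Unshelve. all: end_near. Qed.

Hypothesis X_mu2 : ('E_P[(X : T -> R) ^+ 2] = +oo)%E.

Lemma cvg_tmoment2 : U x @[x --> +oo] --> +oo.
Proof.
have := cvg_tmoment (k := 2) X_pos; rewrite X_mu2 => /cvgeryP Un.
apply/cvgryPge => A; move/cvgryPge : Un => /(_ A) [n _ nA].
near=> x; apply: le_trans (nA n (leqnn n)) _; apply: le_tmoment => //.
Unshelve. all: end_near. Qed.

Lemma tmoment2_gt0 : \forall x \near +oo, 0 < U x.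
Proof. by have /cvgryPgt := cvg_tmoment2; apply. Qed.

Lemma scaled_tail_negligible : W x / U x @[x --> +oo] --> (0 : R).
Proof.
apply/cvgrPdist_le => e e0.
(* Enough halvings for [3 / 8 * K%:R] to exceed [1 / e]. *)
pose K := (Num.truncn (8 / 3 / e)).+1.
have Ke : 1 <= e * (3 / 8 * K%:R).
  have : 8 / 3 / e <= K%:R by rewrite ltW// truncnS_gt.
  by rewrite ler_pdivrMr// ; lra.
near=> x.
have x0 : 0 < x by near: x; exact: nbhs_pinfty_gt.
have Ux : 0 < U x by near: x; exact: tmoment2_gt0.
have h : 3 / 8 * K%:R * W x <= U x - U (x / 2 ^+ K).
  by near: x; exact: tmoment2_dyadic.
have Uk : 0 <= U (x / 2 ^+ K).
  by apply: tmoment_ge0; rewrite divr_ge0 ?exprn_ge0// ltW.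
rewrite sub0r normrN ger0_norm ?(divr_ge0 (scaled_tail_ge0 _) (ltW Ux))//.
rewrite ler_pdivrMr//.
have : W x <= e * (3 / 8 * K%:R) * W x by rewrite ler_peMl// scaled_tail_ge0.
have : e * (3 / 8 * K%:R * W x) <= e * U x by rewrite ler_pM2l//; lra.
lra.
Unshelve. all: end_near. Qed.

Lemma scaled_tail_negligibleZ c : 0 < c ->
  W (c * x) / U x @[x --> +oo] --> (0 : R).
Proof.
move=> c0.
have h : (W (c * x) / W x) * (W x / U x) @[x --> +oo] --> (1 * 0 : R).
  by apply: cvgM; [exact: scaled_tail_slow|exact: scaled_tail_negligible].
rewrite mulr0 in h; apply: near_eq_cvg_pinfty h _; near=> x.
have Wx : 0 < W x by near: x; exact: scaled_tail_gt0.
have Ux : 0 < U x by near: x; exact: tmoment2_gt0.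
by rewrite /=; field; rewrite !gt_eqF.
Unshelve. all: end_near. Qed.

(** The increment is at most [|c^2 - 1| * W x] when c >= 1 and [|c^2 - 1| * W (c * x) / c^2] when c
    < 1; adding the two nonnegative bounds covers both cases. *)
Lemma tmoment2_diff c x : 0 < c -> 0 < x ->
  `|U (c * x) - U x| <= `|c ^+ 2 - 1| * (W x + W (c * x) / c ^+ 2).
Proof.
move=> c0 x0; have cx0 : 0 < c * x by rewrite mulr_gt0.
have W0 := scaled_tail_ge0 x.
have W1 : 0 <= W (c * x) / c ^+ 2 by rewrite divr_ge0 ?scaled_tail_ge0 ?sqr_ge0.
have [c1|c1] := leP 1 c.
  have xcx : x <= c * x by apply: ler_peMl => //; exact: ltW.
  have c2 : 0 <= c ^+ 2 - 1 by rewrite subr_ge0 exprn_ege1.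
  rewrite (ger0_norm c2) ger0_norm; last by rewrite subr_ge0 le_tmoment// ltW.
  apply: le_trans (tmoment2_upper X (ltW x0) xcx) _.
  rewrite (_ : _ * tail X x = (c ^+ 2 - 1) * W x); last by rewrite /W; ring.
  by rewrite ler_wpM2l// lerDl.
have xcx : c * x <= x by apply: ler_piMl; exact: ltW.
have c2 : 0 <= 1 - c ^+ 2 by rewrite subr_ge0 exprn_ile1// ltW.
rewrite distrC (distrC _ 1) (ger0_norm c2) ger0_norm; last first.
  by rewrite subr_ge0 le_tmoment// ltW.
apply: le_trans (tmoment2_upper X (ltW cx0) xcx) _.
rewrite (_ : _ * tail X _ = (1 - c ^+ 2) * (W (c * x) / c ^+ 2)); last first.
  by rewrite /W; field; rewrite gt_eqF.
by rewrite ler_wpM2l// lerDr.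
Qed.

Lemma tmoment2_slow c : 0 < c -> U (c * x) / U x @[x --> +oo] --> (1 : R).
Proof.
move=> c0; apply: cvg_zero.
have h : `|c ^+ 2 - 1| * (W x / U x + W (c * x) / U x / c ^+ 2) @[x --> +oo] -->
    `|c ^+ 2 - 1| * (0 + 0 / c ^+ 2).
  apply: cvgM; first exact: cvg_cst.
  apply: cvgD; first exact: scaled_tail_negligible.
  by apply: cvgM; [exact: scaled_tail_negligibleZ|exact: cvg_cst].
rewrite mul0r addr0 mulr0 in h.
apply: norm_cvg0; apply: (squeeze_cvgr _ (cvg_cst 0) h); near=> x.
rewrite normr_ge0/=.
have x0 : 0 < x by near: x; exact: nbhs_pinfty_gt.
have Ux : 0 < U x by near: x; exact: tmoment2_gt0.
rewrite !fctE (_ : _ - _ = (U (c * x) - U x) / U x); last first.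
  by field; rewrite gt_eqF.
rewrite normrM normfV (gtr0_norm Ux) ler_pdivrMr//.
apply: le_trans (tmoment2_diff c0 x0) _.
rewrite [leRHS](_ : _ = `|c ^+ 2 - 1| * (W x + W (c * x) / c ^+ 2))//.
by field; rewrite !gt_eqF.
Unshelve. all: end_near. Qed.

(* [W (2 x) <= 3/2 W x] ultimately, so along [2^k x0] the increments of the
   truncated mean decrease like [(3/4)^k]. *)
Lemma tmoment1_bounded : exists B, forall n, M n%:R <= B.
Proof.
have h : \forall x \near +oo, W (2 * x) / W x < 3 / 2.
  by have /cvgr_lt := @scaled_tail_slow 2 ltac:(lra); apply; lra.
have : \forall x \near +oo, [/\ 1 <= x, 0 < W x & W (2 * x) / W x < 3 / 2].
  near=> x; split; near: x => //; [exact: nbhs_pinfty_ge|exact: scaled_tail_gt0].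
move=> [A [_ HA]]; pose x0 := A + 1.
have {}HA x : x0 <= x -> [/\ 1 <= x, 0 < W x & W (2 * x) <= 3 / 2 * W x].
  move=> xx0; have [] := HA x; first by rewrite (lt_le_trans _ xx0)// ltrDl.
  by move=> ? W0; rewrite ltr_pdivrMr// => /ltW.
have [x01 W0 _] := HA _ (lexx _).
have x0k k : x0 <= 2 ^+ k * x0.
  by rewrite ler_peMl ?exprn_ege1 ?ler1n//; lra.
have Wk k : W (2 ^+ k * x0) <= (3 / 2) ^+ k * W x0.
  elim: k => [|k IH]; first by rewrite !expr0 !mul1r.
  have [_ _] := HA _ (x0k k); rewrite mulrA -exprS => /le_trans; apply.
  by rewrite exprS; move: IH; clear; lra.
(* [4 * (1 - (3 / 4) ^+ k)] is the partial sum of the geometric series of ratio 3/4. An increment is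
   at most [y * tail X y = W y / y], where W grows by at most 3/2 while y doubles; [x0 >= 1]
   disposes of the remaining factor. *)
have Mk k : M (2 ^+ k * x0) <= M x0 + 4 * (1 - (3 / 4) ^+ k) * W x0.
  elim: k => [|k IH].
    by rewrite !expr0 mul1r subrr mulr0 mul0r addr0.
  have p0 : 0 < 2 ^+ k :> R by rewrite exprn_gt0.
  have y0 : 0 < 2 ^+ k * x0 by rewrite mulr_gt0//; lra.
  have := @tmoment1_upper _ _ _ _ X (2 ^+ k * x0) (2 ^+ k.+1 * x0) (ltW y0).
  rewrite exprS -mulrA; set y := _ * x0 in IH y0 *.
  move=> /(_ ltac:(lra)) h1.
  suff : y * tail X y <= (3 / 4) ^+ k * W x0.
    by rewrite exprS; move: h1 IH; lra.
  have -> : y * tail X y = W y / y by rewrite /W; field; rewrite gt_eqF.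
  rewrite ler_pdivrMr//; apply: le_trans (Wk k) _.
  have -> : (3 / 2 : R) = 3 / 4 * 2 by lra.
  rewrite exprMn (_ : _ * W x0 * y = (3 / 4) ^+ k * 2 ^+ k * W x0 * x0); last first.
    by rewrite /y; ring.
  by apply: ler_peMr => //; rewrite mulr_ge0 ?(ltW W0)// mulr_ge0// exprn_ge0//; lra.
exists (M x0 + 4 * W x0) => n.
apply: le_trans (_ : M (2 ^+ n * x0) <= _).
  apply: le_tmoment => //; apply: le_trans (_ : n%:R <= 2 ^+ n) _.
    by rewrite -natrX ler_nat ltnW// ltn_expl.
  by rewrite ler_peMr// exprn_ge0.
apply: le_trans (Mk n) _; rewrite lerD2l ler_wpM2r ?(ltW W0)//.
have : 0 <= (3 / 4 : R) ^+ n by rewrite exprn_ge0.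
lra.
Unshelve. all: end_near. Qed.

Local Notation mu := (fine 'E_P[X]%E).

(** The mean is proved finite from the tail, so [fine] in the limits returns the actual mean and not
    its default value 0. *)
Lemma expectation_fin : 'E_P[X]%E \is a fin_num.
Proof.
have [B MB] := tmoment1_bounded.
have := cvg_tmoment (k := 1) X_pos; rewrite expr1 => h.
rewrite ge0_fin_numE.
  apply: le_lt_trans (ltry B); apply: cvge_le h; near=> n.
  by rewrite lee_fin.
apply: cvge_ge h; near=> n; rewrite lee_fin; exact: tmoment_ge0.
Unshelve. all: end_near. Qed.

Lemma cvg_tmoment1_nat : M n%:R @[n --> \oo] --> mu.
Proof.
have := cvg_tmoment (k := 1) X_pos; rewrite expr1 -(fineK expectation_fin).
by move=> /fine_cvgP[].
Qed.

Lemma tmoment1_le_mean x : 0 <= x -> M x <= mu.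
Proof.
move=> x0; rewrite -(cvg_lim _ cvg_tmoment1_nat)//; apply: limr_ge.
  by apply: cvgP; exact: cvg_tmoment1_nat.
near=> n; apply: le_tmoment => //; near: n; exact: nbhs_infty_ger.
Unshelve. all: end_near. Qed.

Lemma cvg_tmoment1 : M x @[x --> +oo] --> mu.
Proof.
apply/cvgrPdist_le => e e0.
have /cvgrPdist_le/(_ _ e0) [n _ /(_ n (leqnn n)) /= hn] := cvg_tmoment1_nat.
near=> x.
have x0 : 0 <= x by near: x; exact: nbhs_pinfty_ge.
have nx : n%:R <= x by near: x; exact: nbhs_pinfty_ge.
rewrite ger0_norm ?subr_ge0 ?tmoment1_le_mean//.
apply: le_trans hn; rewrite ger0_norm ?subr_ge0 ?tmoment1_le_mean//.
by rewrite lerD2l lerN2 le_tmoment.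
Unshelve. all: end_near. Qed.

Lemma mean_gt0 : 0 < mu.
Proof.
have [x [x0 Wx]] : exists x, 0 < x /\ 0 < W x.
  apply: (@filter_ex _ (+oo : set_system R)); near=> x; split; near: x.
    exact: nbhs_pinfty_gt.
  exact: scaled_tail_gt0.
apply: lt_le_trans (tmoment1_le_mean (ltW x0)).
apply: lt_le_trans (tmoment1_lower X (ltW x0)).
by rewrite -(@pmulr_rgt0 _ x)// mulrA -expr2.
Unshelve. all: end_near. Qed.

(** A consequence of the finite mean: fix b with [M x - M b] at most e / 4 for all x >= b; then
    [U x] exceeds the constant [b ^ 2] by at most [2 * x * (e / 4)]. *)
Lemma tmoment2_sublinear : U x / x @[x --> +oo] --> (0 : R).
Proof.
apply/cvgrPdist_le => e e0.
have e4 : 0 < e / 4 by rewrite divr_gt0.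
have /cvgrPdist_le/(_ _ e4) [b _ /(_ b (leqnn b)) /= hb] := cvg_tmoment1_nat.
rewrite ger0_norm ?subr_ge0 ?tmoment1_le_mean// in hb.
near=> x.
have x0 : 0 < x by near: x; exact: nbhs_pinfty_gt.
have bx : b%:R <= x by near: x; exact: nbhs_pinfty_ge.
have be : b%:R ^+ 2 <= x * (e / 2).
  by rewrite -ler_pdivrMr ?divr_gt0//; near: x; exact: nbhs_pinfty_ge.
rewrite sub0r normrN ger0_norm; last first.
  by rewrite divr_ge0// ?tmoment_ge0// ltW.
rewrite ler_pdivrMr//; apply: le_trans (tmoment2_le X (ler0n R b) bx) _.
have hx : M x - M b%:R <= e / 4.
  by apply: le_trans hb; rewrite lerD2r tmoment1_le_mean// ltW.
have : 2 * x * (M x - M b%:R) <= 2 * x * (e / 4) by rewrite ler_wpM2l// mulr_ge0// ltW.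
by move: be; clear; lra.
Unshelve. all: end_near. Qed.

End infinite_second_moment.

(** * Layer-cake formula for the truncated second moment *)

Section layer_cake.
Context d (T : measurableType d) (R : realType) (P : probability T R).
Variable X : {RV P >-> R}.
Implicit Types a b x u : R.

Local Notation leb := (@lebesgue_measure R).

Lemma integral_double a b : 0 <= a -> a <= b ->
  (\int[leb]_(u in `]a, b]) (2 * u)%:E = (b ^+ 2 - a ^+ 2)%:E)%E.
Proof.
move=> a0; rewrite le_eqVlt => /predU1P[->|ab].
  by rewrite set_itv_ge ?integral_set0 ?subrr// bnd_simp ltxx.
rewrite integral_itv_obnd_cbnd; last first.
  by apply/measurable_EFinP; apply: measurable_funTS; exact: measurable_funM.
rewrite (@continuous_FTC2 _ _ (fun u => u ^+ 2))//.
- apply: continuous_subspaceT => u; apply: cvgM; [exact: cvg_cst|exact: cvg_id].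
- split.
  + by move=> u _; exact: exprn_derivable.
  + by apply: cvg_at_right_filter; exact: exprn_continuous.
  + by apply: cvg_at_left_filter; exact: exprn_continuous.
- by move=> u _; rewrite exp_derive1 expr1 -mulr_natl.
Qed.

(** The Tonelli integrand: integrating in u first gives the increment of the squared truncation,
    integrating in w first gives [2 * u * tail X u]. *)
Definition layer a x (z : T * R) : R :=
  if (a < z.2 <= x) && (z.2 < X z.1) then 2 * z.2 else 0.

Lemma measurable_layer a x : measurable_fun setT (EFin \o layer a x).
Proof.
apply/measurable_EFinP; apply: measurable_fun_ifT => //.
  apply: measurable_and.
    by apply: measurable_and; [exact: measurable_fun_ltr|exact: measurable_fun_ler].
  apply: measurable_fun_ltr => //.
  exact: (measurableT_comp (measurable_funPT X)).
exact: measurable_funM.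
Qed.

Lemma integral_layer_level a x w : 0 <= a -> a <= x ->
  (\int[leb]_u (layer a x (w, u))%:E =
   (trunc x (X w) ^+ 2 - trunc a (X w) ^+ 2)%:E)%E.
Proof.
move=> a0 ax; have x0 := le_trans a0 ax.
(* [D] will be the part of ]a, x] that lies below [X w], when there is one. *)
have itvE b c : 0 <= b -> b <= c -> forall D : set R, measurable D ->
    (forall u, layer a x (w, u) = if u \in D then 2 * u else 0) ->
    (\int[leb]_(u in D) (2 * u)%:E = (c ^+ 2 - b ^+ 2)%:E)%E ->
    (\int[leb]_u (layer a x (w, u))%:E = (c ^+ 2 - b ^+ 2)%:E)%E.
  move=> b0 bc D mD lD <-; rewrite [RHS]integral_mkcond; apply: eq_integral => u _.
  by rewrite lD patchE; case: ifPn.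
case: (truncP (X w) a0) => [w0 _|w0 wa|aw _].
- rewrite (_ : trunc _ _ = 0); last by case: (truncP (X w) x0) => //; lra.
  rewrite subrr integral0_eq// => u _; rewrite /layer/=; case: ifPn => // h.
  by exfalso; move: h => /andP[/andP[? _] ?]; lra.
- rewrite (_ : trunc _ _ = X w); last by case: (truncP (X w) x0) => //; lra.
  rewrite subrr integral0_eq// => u _; rewrite /layer/=; case: ifPn => // h.
  by exfalso; move: h => /andP[/andP[? _] ?]; lra.
- case: (truncP (X w) x0) => [w0 _|w0 wx|xw _].
  + by exfalso; lra.
  + apply: (itvE _ _ a0 (ltW aw) `]a, X w[%classic) => //.
      move=> u; rewrite /layer/= mem_setE in_itv/=.
      have [au|]//= := ltP a u; have [uw|]//= := ltP u (X w).
        by rewrite (ltW (lt_le_trans uw wx)).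
      by rewrite andbF.
    rewrite integral_itv_bndo_bndc ?integral_double ?(ltW aw)//.
    by apply/measurable_EFinP; apply: measurable_funTS; exact: measurable_funM.
  + apply: (itvE _ _ a0 ax `]a, x]%classic) => //; last by rewrite integral_double.
    move=> u; rewrite /layer/= mem_setE in_itv/=.
    have [au|]//= := ltP a u; have [ux|]//= := leP u x.
    by rewrite (le_lt_trans ux xw).
Qed.

Lemma integral_layer_tail a x u : 0 <= a ->
  (\int[P]_w (layer a x (w, u))%:E =
   (if a < u <= x then 2 * u * tail X u else 0)%:E)%E.
Proof.
move=> a0; rewrite /layer/=; case: ifPn => [_|_]; last by rewrite integral0.
have bZ : bounded_measurable (fun w => 2 * u * (u < X w)%R%:R).
  apply: bounded_measurableM; first exact: bounded_measurable_cst.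
  exact: bounded_measurable_tail.
rewrite -expectation_tail -bounded_expectationZ; last exact: bounded_measurable_tail.
rewrite EFin_bounded_expectation//; apply: eq_integral => w _ /=.
by case: ifPn; rewrite ?mulr1 ?mulr0.
Qed.

Lemma measurable_tail : measurable_fun setT (tail X).
Proof.
rewrite (_ : tail X = fun x => 1 - fine (cdf X x)).
  apply: measurable_funB => //; apply: nondecreasing_measurable => //.
  exact: le_fine_cdf.
by apply/funext => x; rewrite tailE.
Qed.

Lemma tail_le1 x : tail X x <= 1.
Proof. by apply: prob_le1; exact: measurable_gt_RV. Qed.

Lemma integrable_tail a x : 0 <= a ->
  leb.-integrable `]a, x] (EFin \o (fun u => u * tail X u)).
Proof.
move=> a0; have fin_itv : (leb `]a, x]%classic < +oo)%E.
  by rewrite lebesgue_measure_itv/= lte_fin; case: ifPn => // _; rewrite -EFinD ltry.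
apply: measurable_bounded_integrable => //.
- apply: measurable_funTS; apply: measurable_funM => //; exact: measurable_tail.
- exists x; split; [exact: num_real|move=> y xy u /=].
  rewrite in_itv/= => /andP[au ux]; have u0 : 0 <= u by rewrite ltW// (le_lt_trans a0).
  rewrite normrM !ger0_norm ?tail_ge0//; apply: le_trans (ltW xy); apply: le_trans ux.
  by rewrite ler_piMr// tail_le1.
Qed.

(** The lower end a stays free because [l] and W are comparable only beyond a threshold. *)
Lemma tmoment2_integral a x : 0 <= a -> a <= x ->
  tmoment X 2 x - tmoment X 2 a = 2 * \int[leb]_(u in `]a, x]) (u * tail X u).
Proof.
move=> a0 ax; have x0 := le_trans a0 ax.
have int := integrable_tail x a0.
apply: EFin_inj; rewrite -RintegralZl// fineK; last first.
  have int2 : leb.-integrable `]a, x] (fun u => 2%:E * (u * tail X u)%:E)%E.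
    exact: integrableZl.
  exact: integrable_fin_num int2.
have bN : bounded_measurable (fun w => - 1 * trunc a (X w) ^+ 2).
  by apply: bounded_measurableM; [exact: bounded_measurable_cst|exact: bounded_measurable_trunc].
rewrite (_ : _ - _ = tmoment X 2 x + - 1 * tmoment X 2 a); last by rewrite mulN1r.
rewrite -bounded_expectationZ; last exact: bounded_measurable_trunc.
rewrite -bounded_expectationD//; last exact: bounded_measurable_trunc.
rewrite EFin_bounded_expectation; last first.
  by apply: bounded_measurableD => //; exact: bounded_measurable_trunc.
transitivity (\int[P]_w \int[leb]_u (layer a x (w, u))%:E)%E.
  by apply: eq_integral => w _; rewrite integral_layer_level// mulN1r.
transitivity (\int[leb]_u \int[P]_w (layer a x (w, u))%:E)%E.
  apply: (@fubini_tonelli _ _ _ _ R P leb (EFin \o layer a x)); first exact: measurable_layer.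
  move=> z; rewrite lee_fin /layer; case: ifPn => // /andP[/andP[az _] _].
  by rewrite mulr_ge0// ltW// (le_lt_trans a0).
rewrite [RHS]integral_mkcond; apply: eq_integral => u _ /=.
rewrite integral_layer_tail// patchE mem_setE in_itv/=.
by case: ifPn => // _; rewrite mulrA.
Qed.

End layer_cake.

(** * Comparison of [ltilde l] with the truncated second moment *)

Section ltilde_asymptotics.
Context d (T : measurableType d) (R : realType) (P : probability T R).
Variables (X : {RV P >-> R}) (l : R -> R).
Hypothesis X_pos : P [set w | 0 < X w] = 1%E.
Hypothesis X_pareto : pareto_type P X 2 l.
Hypothesis X_mu2 : ('E_P[(X : T -> R) ^+ 2] = +oo)%E.
Hypothesis l_int : forall x : R, 0 < x ->
  lebesgue_measure.-integrable `]0, x] (fun u : R => (l u / u)%:E).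
Implicit Types a x : R.

Local Notation U := (tmoment X 2).
Local Notation leb := (@lebesgue_measure R).

Lemma integrable_sub_itv a x : 0 < a ->
  leb.-integrable `]a, x] (fun u : R => (l u / u)%:E).
Proof.
move=> a0; have [ax|xa] := ltP a x; last first.
  by rewrite set_itv_ge ?bnd_simp -?leNgt//; exact: integrable_set0.
apply: (integrableS _ _ _ (l_int (lt_trans a0 ax))) => //.
by move=> u /=; rewrite !in_itv/= => /andP[au ->]; rewrite andbT (lt_trans a0).
Qed.

Lemma ltilde_sub a x : 0 < a -> a <= x ->
  ltilde l x - ltilde l a = \int[leb]_(u in `]a, x]) (l u / u).
Proof.
move=> a0 ax; apply: Rintegral_itvB; rewrite ?bnd_simp//; last exact: ltW.
exact: l_int (lt_le_trans a0 ax).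
Qed.

(** After division by u the hypothesis reads [l u / u = (1 +- e) * (u * tail X u)], and the integral
    of [u * tail X u] is half the increment of U. *)
Lemma ltilde_sub_bounds (e a x : R) : 0 < a -> a <= x ->
  (forall u, a < u -> `|l u - scaled_tail X u| <= e * scaled_tail X u) ->
  `|ltilde l x - ltilde l a - (U x - U a) / 2| <= e * ((U x - U a) / 2).
Proof.
move=> a0 ax H.
have it := integrable_tail X x (ltW a0).
have il := integrable_sub_itv x a0.
have UE : (U x - U a) / 2 = \int[leb]_(u in `]a, x]) (u * tail X u).
  by rewrite tmoment2_integral ?(ltW a0)// mulrC mulKf.
have itZ c : leb.-integrable `]a, x] (EFin \o (fun u => c * (u * tail X u))).
  rewrite (_ : _ \o _ = fun u => (c%:E * (u * tail X u)%:E)%E); first exact: integrableZl.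
  by apply/funext => u; rewrite /= EFinM.
have {}H u : u \in `]a, x]%classic ->
    (1 - e) * (u * tail X u) <= l u / u <= (1 + e) * (u * tail X u).
  rewrite inE/= in_itv/= => /andP[au _].
  have u0 : 0 < u by exact: lt_trans au.
  have := H u au; rewrite /scaled_tail ler_norml => /andP[h1 h2].
  rewrite ler_pdivlMr// ler_pdivrMr//; apply/andP; split; lra.
have h1 : (1 - e) * ((U x - U a) / 2) <= ltilde l x - ltilde l a.
  rewrite UE ltilde_sub// -RintegralZl//; apply: le_Rintegral => // u.
  by move=> /mem_set/H/andP[].
have h2 : ltilde l x - ltilde l a <= (1 + e) * ((U x - U a) / 2).
  rewrite UE ltilde_sub// -RintegralZl//; apply: le_Rintegral => // u.
  by move=> /mem_set/H/andP[].
by rewrite ler_norml; apply/andP; split; lra.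
Qed.

Lemma ltilde_equiv : ltilde l x / U x @[x --> +oo] --> (2^-1 : R).
Proof.
apply/cvgrPdist_le => e e0.
have [a [a0 Ha]] : exists a, 0 < a /\
    forall u, a < u -> `|l u - scaled_tail X u| <= e * scaled_tail X u.
  have W1 : (scaled_tail X x / l x)^-1 @[x --> +oo] --> (1^-1 : R).
    by apply: cvgV; [exact: oner_neq0|exact: scaled_tail_equiv].
  have : \forall u \near +oo, `|l u - scaled_tail X u| <= e * scaled_tail X u.
    move: W1; rewrite invr1 => /cvgrPdist_le/(_ _ e0) W1.
    near=> u; have Wu : 0 < scaled_tail X u.
      by near: u; exact: scaled_tail_gt0 X_pareto.
    have : `|1 - (scaled_tail X u / l u)^-1| <= e by near: u.
    rewrite invfM invrK (_ : 1 - _ = (scaled_tail X u - l u) / scaled_tail X u).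
      by rewrite normrM normfV (gtr0_norm Wu) ler_pdivrMr// distrC.
    by field; rewrite gt_eqF.
  move=> [b [_ Hb]]; exists (Num.max b 1); split; first by rewrite lt_max ltr01 orbT.
  by move=> u; rewrite gt_max => /andP[/Hb].
near=> x.
have Ux : 0 < U x by near: x; exact: tmoment2_gt0 X_pos X_mu2.
have ax : a <= x by near: x; exact: nbhs_pinfty_ge (num_real a).
have Ua := tmoment_ge0 X 2 (ltW a0).
(* On ]0, a] nothing compares [l] with W, but this part contributes a constant, which is absorbed
   because U diverges. *)
have cx : `|ltilde l a - U a / 2| <= U x * (e / 2).
  rewrite -ler_pdivrMr ?divr_gt0//; near: x.
  by have /cvgryPge := cvg_tmoment2 X_pos X_mu2; apply.
have := ltilde_sub_bounds a0 ax Ha => h.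
rewrite distrC (_ : _ - _ = (ltilde l x - U x / 2) / U x); last first.
  by field; rewrite gt_eqF.
rewrite normrM normfV (gtr0_norm Ux) ler_pdivrMr//.
move: cx h; rewrite !ler_norml => /andP[c1 c2] /andP[h1 h2].
have : 0 <= e * U a by rewrite mulr_ge0// ltW.
by move=> ?; apply/andP; split; lra.
Unshelve. all: end_near. Qed.

(** [l] may change sign near 0, so [ltilde l] need not be monotone; it is the difference of the
    integrals of the positive and negative parts, each nondecreasing in the upper end. *)
Lemma measurable_ltilde : measurable_fun (`]0, +oo[ : set R) (ltilde l).
Proof.
pose f (u : R) := (l u / u)%:E.
have mono (g : R -> \bar R) : (forall u, 0 <= g u)%E ->
    (forall x : R, 0 < x -> leb.-integrable `]0, x] g) ->
    {homo (fun x : R => fine (\int[leb]_(u in `]0%R, x]) g u)%E) : x y / x <= y}.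
  move=> g0 ig x y xy; have [x0|x0] := leP x 0.
    rewrite set_itv_ge ?bnd_simp -?leNgt// integral_set0 fine_ge0//.
    exact: integral_ge0.
  have y0 := lt_le_trans x0 xy.
  apply: fine_le; [exact: integrable_fin_num (ig _ x0)|exact: integrable_fin_num (ig _ y0)|].
  apply: ge0_subset_integral => //; first exact: measurable_int (ig _ y0).
  by move=> u /=; rewrite !in_itv/= => /andP[->/=] /le_trans; apply.
have mf (g : R -> \bar R) : (forall u, 0 <= g u)%E ->
    (forall x : R, 0 < x -> leb.-integrable `]0, x] g) ->
    measurable_fun (`]0, +oo[ : set R) (fun x : R => fine (\int[leb]_(u in `]0%R, x]) g u)%E).
  by move=> g0 ig; apply: nondecreasing_measurable => //; exact: mono.
apply: (eq_measurable_fun (fun x : R => fine (\int[leb]_(u in `]0%R, x]) f^\+ u)%E -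
                               fine (\int[leb]_(u in `]0%R, x]) f^\- u)%E)).
  move=> x; rewrite inE/= in_itv/= andbT => x0.
  have ip : leb.-integrable `]0, x] (f^\+)%E by apply: integrable_funepos => //; exact: l_int.
  have im : leb.-integrable `]0, x] (f^\-)%E by apply: integrable_funeneg => //; exact: l_int.
  have fp := integrable_fin_num _ ip.
  have fm := integrable_fin_num _ im.
  by rewrite -fineB ?fp ?fm// -integralE.
apply: measurable_funB; apply: mf => //.
- by move=> x x0; apply: integrable_funepos => //; exact: l_int.
- by move=> x x0; apply: integrable_funeneg => //; exact: l_int.
Qed.

Lemma ltilde_slowly_varying : slowly_varying (ltilde l).
Proof.
split; first exact: measurable_ltilde.
- have h : \forall x \near +oo, 0 < ltilde l x / U x.
    by have /cvgr_gt := ltilde_equiv; apply; rewrite invr_gt0.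
  near=> x.
  have Ux : 0 < U x by near: x; exact: tmoment2_gt0 X_pos X_mu2.
  have : 0 < ltilde l x / U x by near: x.
  by rewrite pmulr_lgt0// invr_gt0.
- move=> c c0.
  have E := ltilde_equiv.
  have h : (ltilde l (c * x) / U (c * x)) * (U (c * x) / U x) / (ltilde l x / U x)
      @[x --> +oo] --> (2^-1 * 1 / 2^-1 : R).
    apply: cvgM; first apply: cvgM.
    + exact: cvg_pinftyZ c0 E.
    + exact: tmoment2_slow X_pos X_pareto X_mu2 c c0.
    + by apply: cvgV => //; rewrite invr_neq0.
  rewrite mulr1 divff ?invr_neq0// in h.
  have gt0 : \forall x \near +oo, 0 < ltilde l x / U x.
    by have /cvgr_gt := ltilde_equiv; apply; rewrite invr_gt0.
  have Ugt0 := tmoment2_gt0 X_pos X_mu2.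
  apply: near_eq_cvg_pinfty h _; near=> x.
  have Ux : 0 < U x by near: x.
  have Ucx : 0 < U (c * x) by near: x; exact: (near_pinftyZ c0 Ugt0).
  have lx : 0 < ltilde l x.
    have : 0 < ltilde l x / U x by near: x.
    by rewrite pmulr_lgt0// invr_gt0.
  by field; rewrite !gt_eqF.
Unshelve. all: end_near. Qed.

End ltilde_asymptotics.

(** * Weak law for independent copies *)

Section independent_products.
Context d (T : measurableType d) (R : realType) (P : probability T R).

(* The law of an independent pair is the product of the marginal laws. *)
Lemma expectation_indepM (X Y : {RV P >-> R}) (f g : R -> R) :
  (forall A B, measurable A -> measurable B ->
    P (X @^-1` A `&` Y @^-1` B) = (P (X @^-1` A) * P (Y @^-1` B))%E) ->
  measurable_fun setT f -> measurable_fun setT g ->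
  (forall x, 0 <= f x) -> (forall x, 0 <= g x) ->
  (\int[P]_w (f (X w) * g (Y w))%:E =
   \int[P]_w (f (X w))%:E * \int[P]_w (g (Y w))%:E)%E.
Proof.
move=> ind mf mg f0 g0.
pose Z w := (X w, Y w).
have mZ : measurable_fun setT Z by exact: measurable_fun_pair.
pose ZM : {mfun T >-> (R * R)%type} := mfun_Sub (mem_set mZ).
have prodE := @product_measure_unique _ _ _ _ R (distribution P X)
  (distribution P Y) (distribution P ZM).
have mfg : measurable_fun setT (fun z : R * R => (f z.1 * g z.2)%:E).
  apply/measurable_EFinP; apply: measurable_funM.
    exact: (measurableT_comp mf).
  exact: (measurableT_comp mg).
have fg0 (z : R * R) : (0 <= (f z.1 * g z.2)%:E)%E by rewrite lee_fin mulr_ge0.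
transitivity (\int[distribution P ZM]_z (f z.1 * g z.2)%:E)%E.
  by rewrite ge0_integral_distribution.
transitivity (\int[(distribution P X \x distribution P Y)%E]_z (f z.1 * g z.2)%:E)%E.
  apply: eq_measure_integral => A mA _; exact/esym/prodE.
rewrite fubini_tonelli1//= /fubini_F/=.
under eq_integral => x _.
  under eq_integral do rewrite EFinM.
  rewrite ge0_integralZl_EFin//; [|by move=> y _; rewrite lee_fin|exact/measurable_EFinP].
  over.
rewrite ge0_integralZr//; last 3 first.
- exact/measurable_EFinP.
- by move=> x _; rewrite lee_fin.
- by apply: integral_ge0 => y _; rewrite lee_fin.
congr (_ * _)%E.
- have Ef0 y : (0 <= (EFin \o f) y)%E by rewrite lee_fin.
  by apply: (ge0_integral_distribution X _ Ef0); exact/measurable_EFinP.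
- have Eg0 y : (0 <= (EFin \o g) y)%E by rewrite lee_fin.
  by apply: (ge0_integral_distribution Y _ Eg0); exact/measurable_EFinP.
Qed.

End independent_products.

Section iid_weak_law.
Context d (T : measurableType d) (R : realType) (P : probability T R).
Variables (X : {RV P >-> R}) (Xs : nat -> {RV P >-> R}).
Hypothesis Xs_iid : iid_copies P X Xs.

Lemma iid_copies_pair i j (A B : set R) : i != j -> measurable A -> measurable B ->
  P (Xs i @^-1` A `&` Xs j @^-1` B) = (P (Xs i @^-1` A) * P (Xs j @^-1` B))%E.
Proof.
move=> ij mA mB; have [ind _] := Xs_iid.
pose C k := if k == i then A else B.
have Ci : C i = A by rewrite /C eqxx.
have Cj : C j = B by rewrite /C eq_sym (negbTE ij).
have mC k : measurable (C k) by rewrite /C; case: ifP.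
have := ind (i |` [fset j])%fset C mC.
rewrite big_fsetU1 ?in_fset1// big_seq_fset1 Ci Cj => <-; congr (P _).
apply/seteqP; split=> w.
  by move=> [wi wj] k /=; rewrite in_fset1U in_fset1 => /orP[] /eqP ->; rewrite ?Ci ?Cj.
move=> H; split.
  by have := H i; rewrite Ci; apply; rewrite /= in_fset1U eqxx.
by have := H j; rewrite Cj; apply; rewrite /= in_fset1U in_fset1 eqxx orbT.
Qed.

Lemma iid_copies_expectation i (f : R -> R) : measurable_fun setT f ->
  (forall x, 0 <= f x) -> \int[P]_w f (Xs i w) = \int[P]_w f (X w).
Proof.
move=> mf f0; have [_ dist] := Xs_iid; rewrite /Rintegral; congr fine.
have mEf : measurable_fun setT (EFin \o f) by exact/measurable_EFinP.
have Ef0 y : (0 <= (EFin \o f) y)%E by rewrite lee_fin.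
rewrite -(ge0_integral_distribution (Xs i) mEf Ef0).
rewrite -(ge0_integral_distribution X mEf Ef0).
by apply: eq_measure_integral => A mA _; exact: dist.
Qed.

Section truncated_sum.
Variables (f : R -> R) (K : R).
Hypothesis mf : measurable_fun setT f.
Hypothesis f0 : forall x, 0 <= f x.
Hypothesis fK : forall x, f x <= K.

Let m := \int[P]_w f (X w).
Let v := \int[P]_w (f (X w) ^+ 2).
Let Z i w := f (Xs i w) - m.
Let S n w := \sum_(i < n) Z i w.

Let bfX (Y : {RV P >-> R}) : bounded_measurable (fun w => f (Y w)).
Proof.
split; first exact: measurableT_comp.
by exists K => w; rewrite ger0_norm.
Qed.

Let bZ i : bounded_measurable (Z i).
Proof.
apply: bounded_measurableD (bfX (Xs i)) _; exact: (bounded_measurable_cst _ (- m)).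
Qed.

Let bS n : bounded_measurable (S n).
Proof. exact: bounded_measurable_sum. Qed.

Let EZ i : \int[P]_w Z i w = 0.
Proof.
rewrite bounded_expectationD//; last exact: (bounded_measurable_cst _ (- m)).
by rewrite bounded_expectation_cst iid_copies_expectation// subrr.
Qed.

(** The product rule for independent variables is available for nonnegative functions, so it is
    applied to f itself and the centring is expanded by hand. *)
Let EZZ i j : i != j -> \int[P]_w (Z i w * Z j w) = 0.
Proof.
move=> ij.
have bff : bounded_measurable (fun w => f (Xs i w) * f (Xs j w)).
  exact: bounded_measurableM.
have Eff : \int[P]_w (f (Xs i w) * f (Xs j w)) = m * m.
  apply: EFin_inj; rewrite EFin_bounded_expectation// expectation_indepM//; last first.
    by move=> A B; exact: iid_copies_pair.
  rewrite -!EFin_bounded_expectation// !iid_copies_expectation//.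
have bc : bounded_measurable (fun w => - m * f (Xs i w)).
  by apply: bounded_measurableM => //; exact: bounded_measurable_cst.
transitivity (\int[P]_w (f (Xs i w) * f (Xs j w) + (- m * f (Xs i w) + - m * Z j w))).
  by apply: eq_Rintegral => w _; rewrite /Z; ring.
have bc' : bounded_measurable (fun w => - m * Z j w).
  by apply: bounded_measurableM => //; exact: bounded_measurable_cst.
rewrite bounded_expectationD//; last exact: bounded_measurableD.
rewrite bounded_expectationD// !bounded_expectationZ// EZ Eff.
by rewrite iid_copies_expectation// -/m; ring.
Qed.

Let EZ2 i : \int[P]_w (Z i w ^+ 2) <= v.
Proof.
have bf2 : bounded_measurable (fun w => f (Xs i w) ^+ 2).
  by under eq_fun do rewrite expr2; exact: bounded_measurableM.
have bc : bounded_measurable (fun w => - m * f (Xs i w)).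
  by apply: bounded_measurableM => //; exact: bounded_measurable_cst.
have bc' : bounded_measurable (fun w => - m * Z i w).
  by apply: bounded_measurableM => //; exact: bounded_measurable_cst.
rewrite (_ : \int[P]_w (Z i w ^+ 2) = \int[P]_w (f (Xs i w) ^+ 2 +
    (- m * f (Xs i w) + - m * Z i w))); last first.
  by apply: eq_Rintegral => w _; rewrite /Z; ring.
rewrite bounded_expectationD//; last exact: bounded_measurableD.
rewrite bounded_expectationD// !bounded_expectationZ// EZ.
rewrite iid_copies_expectation// -/m (@iid_copies_expectation i (fun x => f x ^+ 2)).
- by rewrite -/v; have := sqr_ge0 m; lra.
- exact: measurable_funX.
- by move=> x; exact: sqr_ge0.
Qed.

(** Separating k from n lets induction on k remove one pairwise covariance at a time; k = n then
    cancels the cross term in the square of the next partial sum. *)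
Let ESZ k n : (k <= n)%N -> \int[P]_w (S k w * Z n w) = 0.
Proof.
elim: k => [_|k IH kn].
  rewrite (_ : (fun w => _) = fun=> 0); first exact: bounded_expectation_cst.
  by apply/funext => w; rewrite /S big_ord0 mul0r.
rewrite (_ : \int[P]_w _ = \int[P]_w (S k w * Z n w + Z k w * Z n w)); last first.
  by apply: eq_Rintegral => w _; rewrite /S big_ord_recr/= mulrDl.
rewrite bounded_expectationD; [|exact: bounded_measurableM..].
by rewrite IH 1?ltnW// EZZ ?addr0// neq_ltn kn.
Qed.

Let ES2 n : \int[P]_w (S n w ^+ 2) <= n%:R * v.
Proof.
elim: n => [|n IH].
  rewrite (_ : (fun w => _) = fun=> 0); first by rewrite bounded_expectation_cst mul0r.
  by apply/funext => w; rewrite /S big_ord0 expr0n.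
have bsq (g : T -> R) : bounded_measurable g -> bounded_measurable (fun w => g w ^+ 2).
  by move=> bg; under eq_fun do rewrite expr2; exact: bounded_measurableM.
have bSZ : bounded_measurable (fun w => S n w * Z n w) by exact: bounded_measurableM.
have b2 : bounded_measurable (fun w => 2 * (S n w * Z n w)).
  by apply: bounded_measurableM => //; exact: bounded_measurable_cst.
rewrite (_ : \int[P]_w _ =
    \int[P]_w (S n w ^+ 2 + (2 * (S n w * Z n w) + Z n w ^+ 2))); last first.
  by apply: eq_Rintegral => w _; rewrite /S big_ord_recr/=; ring.
rewrite bounded_expectationD; [|exact: bsq|by apply: bounded_measurableD => //; exact: bsq].
rewrite bounded_expectationD//; last exact: bsq.
rewrite bounded_expectationZ// ESZ// mulr0 add0r -natr1 mulrDl mul1r.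
by rewrite lerD.
Qed.

(** The raw second moment v bounds the variance. With f the squared truncation, v is the truncated
    fourth moment; with f the truncation, it is U. *)
Lemma iid_sum_chebyshev n (e : R) : 0 < e ->
  prob P [set w | e <= `|\sum_(i < n) f (Xs i w) - n%:R * m|] <= n%:R * v / e ^+ 2.
Proof.
move=> e0.
have -> : [set w | e <= `|\sum_(i < n) f (Xs i w) - n%:R * m|] =
    [set w | e <= `|S n w|].
  apply/seteqP; split=> w /=; rewrite /S /Z sumrB sumr_const card_ord mulr_natl//.
have mA : measurable [set w | e <= `|S n w|].
  rewrite (_ : [set w | _] = (fun w => `|S n w|) @^-1` `[e, +oo[); last first.
    by apply/seteqP; split=> w /=; rewrite in_itv/= andbT.
  rewrite -[X in measurable X]setTI.
  have : measurable_fun setT (fun w => `|S n w|).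
    by apply: measurableT_comp => //; case: (bS n).
  by apply=> //; exact: measurable_itv.
rewrite ler_pdivlMr ?exprn_gt0//; apply: le_trans (ES2 n).
rewrite mulrC -bounded_expectation_indic// -bounded_expectationZ; last first.
  exact: bounded_measurable_indic.
apply: le_bounded_expectation.
- apply: bounded_measurableM; first exact: bounded_measurable_cst.
  exact: bounded_measurable_indic.
- by under eq_fun do rewrite expr2; exact: bounded_measurableM.
- move=> w; rewrite indicE; case: (boolP (w \in _)) => [|_]; last by rewrite mulr0 sqr_ge0.
  rewrite inE/= => eS; rewrite mulr1 -(real_normK (num_real (S n w))).
  by rewrite lerXn2r ?nnegrE// ltW.
Qed.

End truncated_sum.

End iid_weak_law.

(** * Samples of random size *)

Section sample.
Context {R : realType}.
Implicit Types (x : nat -> R) (n : nat).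

Lemma sample_dispersionE x n : (0 < n)%N -> 0 < \sum_(i < n) x i ->
  sample_dispersion x n = sample_C x n - sample_mean x n.
Proof.
move=> n0 sx; rewrite /sample_dispersion /sample_C gtn_eqF//.
have nR : n%:R != 0 :> R by rewrite pnatr_eq0 gtn_eqF.
have mE : n%:R * sample_mean x n = \sum_(i < n) x i.
  by rewrite /sample_mean mulrA divff// mul1r.
rewrite /sample_variance.
have -> : \sum_(i < n) (x i - sample_mean x n) ^+ 2 =
    \sum_(i < n) x i ^+ 2 - n%:R * sample_mean x n ^+ 2.
  under eq_bigr do rewrite sqrrB.
  rewrite big_split/= sumr_const card_ord sumrB.
  rewrite (_ : \sum_(i < n) x i * sample_mean x n *+ 2 =
    2 * (n%:R * sample_mean x n) * sample_mean x n).
    by rewrite -[_ *+ n]mulr_natl; ring.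
  rewrite mE mulr_sumr mulr_suml; apply: eq_bigr => i _.
  by rewrite -mulr_natl mulrA.
have m0 : sample_mean x n != 0.
  by rewrite /sample_mean mulf_neq0 ?invr_neq0// gt_eqF.
rewrite -mE; field; by rewrite nR m0.
Qed.

(* [U] and [M] are meant to be the truncated moments at level [a], and [mu] the
   mean. *)
Definition concentrates (stat : (nat -> R) -> nat -> R) :=
  forall x n (t a U M mu dlt K eta e : R),
  0 < t -> 0 < a -> 0 < mu -> 0 < dlt -> 0 < K -> 0 < eta -> 0 < e ->
  dlt * t <= n%:R -> n%:R <= K * t ->
  `|\sum_(i < n) x i ^+ 2 - n%:R * U| < eta * a ^+ 2 ->
  `|\sum_(i < n) x i - n%:R * M| < eta * t ->
  `|t * U / a ^+ 2 - 2| <= eta / K -> `|M - mu| <= eta / K ->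
  t / a ^+ 2 <= eta ->
  4 * eta <= dlt * mu -> 8 * (mu + 2) * eta <= e * mu ^+ 2 * dlt ->
  4 * eta * mu <= e ->
  `|t / a ^+ 2 * stat x n - 2 / mu| <= e.

(* [t / a^2 C] is the quotient of the rescaled power sums [r2] and [r1], close
   to [2 n / t] and [mu n / t]; [D] differs from [C] by the sample mean, which
   is bounded. *)
Lemma concentrates_statistics :
  concentrates sample_C /\ concentrates sample_dispersion.
Proof.
suff H x n (t a U M mu dlt K eta e : R) :
  0 < t -> 0 < a -> 0 < mu -> 0 < dlt -> 0 < K -> 0 < eta -> 0 < e ->
  dlt * t <= n%:R -> n%:R <= K * t ->
  `|\sum_(i < n) x i ^+ 2 - n%:R * U| < eta * a ^+ 2 ->
  `|\sum_(i < n) x i - n%:R * M| < eta * t ->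
  `|t * U / a ^+ 2 - 2| <= eta / K -> `|M - mu| <= eta / K ->
  t / a ^+ 2 <= eta ->
  4 * eta <= dlt * mu -> 8 * (mu + 2) * eta <= e * mu ^+ 2 * dlt ->
  4 * eta * mu <= e ->
  `|t / a ^+ 2 * sample_C x n - 2 / mu| <= e /\
  `|t / a ^+ 2 * sample_dispersion x n - 2 / mu| <= e.
  split=> x n t a U M mu dlt K eta e t0 a0 mu0 d0 K0 eta0 e0 dn nK h2 h1 hU hM ta c1 c2 c3.
  - by have [] := H x n t a U M mu dlt K eta e t0 a0 mu0 d0 K0 eta0 e0 dn nK h2 h1 hU hM ta c1 c2 c3.
  - by have [] := H x n t a U M mu dlt K eta e t0 a0 mu0 d0 K0 eta0 e0 dn nK h2 h1 hU hM ta c1 c2 c3.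
move=> t0 a0 mu0 d0 K0 eta0 e0 dn nK h2 h1 hU hM ta c1 c2 c3.
have a20 : 0 < a ^+ 2 by rewrite exprn_gt0.
set s2 := \sum_(i < n) x i ^+ 2 in h2 *.
set s1 := \sum_(i < n) x i in h1 *.
pose nu : R := n%:R / t.
have nuE : n%:R = nu * t by rewrite /nu divfK// gt_eqF.
have nud : dlt <= nu by rewrite /nu ler_pdivlMr.
have nuK : nu <= K by rewrite /nu ler_pdivrMr.
have nu0 : 0 < nu by exact: lt_le_trans nud.
have n0 : (0 < n)%N by rewrite -(ltr0n R) nuE mulr_gt0.
pose r2 := s2 / a ^+ 2; pose r1 := s1 / t.
have s2E : s2 = r2 * a ^+ 2 by rewrite /r2 divfK// gt_eqF.
have s1E : s1 = r1 * t by rewrite /r1 divfK// gt_eqF.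
(* Errors in the centring moments are multiplied by nu = n / t, which is at most K; hence the
   tolerances [eta / K]. *)
have nuK1 b : `|b| <= eta / K -> `|nu * b| <= eta.
  move=> hb; rewrite normrM (gtr0_norm nu0).
  apply: le_trans (_ : K * (eta / K) <= _); first by rewrite ler_pM// ltW.
  by rewrite mulrC divfK// gt_eqF.
have {}h2 : `|r2 - 2 * nu| <= 2 * eta.
  have : `|r2 - nu * (t * U / a ^+ 2)| <= eta.
    rewrite (_ : r2 - _ = (s2 - n%:R * U) / a ^+ 2); last first.
      by rewrite /r2 nuE; field; rewrite gt_eqF.
    by rewrite normrM normfV (gtr0_norm a20) ler_pdivrMr// ltW.
  have := nuK1 _ hU; rewrite !ler_norml => /andP[p1 p2] /andP[q1 q2].
  by apply/andP; split; move: p1 p2 q1 q2; clear; lra.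
have {}h1 : `|r1 - nu * mu| <= 2 * eta.
  have : `|r1 - nu * M| <= eta.
    rewrite (_ : r1 - _ = (s1 - n%:R * M) / t); last first.
      by rewrite /r1 nuE; field; rewrite gt_eqF.
    by rewrite normrM normfV (gtr0_norm t0) ler_pdivrMr// ltW.
  have := nuK1 _ hM; rewrite !ler_norml => /andP[p1 p2] /andP[q1 q2].
  by apply/andP; split; move: p1 p2 q1 q2; clear; lra.
have dm : dlt * mu <= nu * mu by rewrite ler_pM2r.
have dm0 : 0 < dlt * mu by rewrite mulr_gt0.
(* From [4 * eta <= dlt * mu]: the deviation [2 * eta] is at most half of [nu * mu], which keeps the
   denominator away from 0. *)
have r1lb : dlt * mu / 2 <= r1.
  by move: h1; rewrite ler_norml => /andP[? ?]; lra.
have r1ub : r1 <= 2 * nu * mu.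
  by move: h1; rewrite ler_norml => /andP[? ?]; lra.
have r10 : 0 < r1 by lra.
have s10 : 0 < s1 by rewrite s1E mulr_gt0.
have CE : t / a ^+ 2 * sample_C x n = r2 / r1.
  rewrite /sample_C gtn_eqF// -/s1 -/s2 s1E s2E; field.
  by rewrite !gt_eqF.
(* Over the common denominator nu cancels. The numerator is at most [2 * eta * (mu + 2)] and the
   denominator at least [dlt * mu ^+ 2 / 2], which explains the condition on
   [8 * (mu + 2) * eta]. *)
have hC : `|r2 / r1 - 2 / mu| <= e / 2.
  rewrite (_ : _ - _ = (mu * (r2 - 2 * nu) - 2 * (r1 - nu * mu)) / (mu * r1)).
    have m1 : 0 < mu * r1 by rewrite mulr_gt0.
    rewrite normrM normfV (gtr0_norm m1) ler_pdivrMr//.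
    apply: le_trans (ler_normB _ _) _; rewrite !normrM (gtr0_norm mu0) normr_nat.
    have p1 : mu * `|r2 - 2 * nu| <= mu * (2 * eta) by rewrite ler_pM2l.
    have p2 : e / 2 * (mu * (dlt * mu / 2)) <= e / 2 * (mu * r1).
      by rewrite ler_pM2l ?divr_gt0// ler_pM2l.
    by move: p1 p2 c2 h1; clear; lra.
  by field; rewrite !gt_eqF.
have he : e / 2 <= e by move: e0; clear; lra.
split; first by rewrite CE (le_trans hC).
rewrite sample_dispersionE// mulrBr CE.
have mE : sample_mean x n = r1 / nu.
  rewrite /sample_mean -/s1 s1E nuE; field.
  by rewrite !gt_eqF.
have m2 : sample_mean x n <= 2 * mu.
  by rewrite mE ler_pdivrMr//; lra.
have m0 : 0 <= sample_mean x n by rewrite mE divr_ge0// ltW.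
(* The other half of e pays for the sample mean: it is at most [2 * mu], and [4 * eta * mu <= e]. *)
have tm : t / a ^+ 2 * sample_mean x n <= e / 2.
  apply: le_trans (_ : eta * (2 * mu) <= _); last by lra.
  by apply: ler_pM => //; rewrite divr_ge0// ltW.
have tm0 : 0 <= t / a ^+ 2 * sample_mean x n by rewrite mulr_ge0// divr_ge0// ltW.
move: hC tm tm0 e0; rewrite !ler_norml; clear.
by move=> /andP[? ?] *; apply/andP; split; lra.
Qed.

End sample.

(** * Moments and tails along the norming function *)

Section norming_function.
Context d (T : measurableType d) (R : realType) (P : probability T R).
Variables (X : {RV P >-> R}) (l a : R -> R).
Hypothesis X_pos : P [set w | 0 < X w] = 1%E.
Hypothesis X_pareto : pareto_type P X 2 l.
Hypothesis X_mu2 : ('E_P[(X : T -> R) ^+ 2] = +oo)%E.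
Hypothesis l_int : forall x : R, 0 < x ->
  lebesgue_measure.-integrable `]0, x] (fun u : R => (l u / u)%:E).
Hypothesis a_infty : a t @[t --> +oo] --> +oo.
Hypothesis a_def : t * a t ^- 2 * ltilde l (a t) @[t --> +oo] --> (1 : R).

Local Notation U := (tmoment X 2).
Local Notation M := (tmoment X 1).
Local Notation W := (scaled_tail X).

Lemma near_norming (Q : R -> Prop) :
  (\forall x \near +oo, Q x) -> \forall t \near +oo, Q (a t).
Proof. by move=> h; apply: a_infty h. Qed.

Lemma cvg_norming (f : R -> R) (b : R) :
  f x @[x --> +oo] --> b -> f (a t) @[t --> +oo] --> b.
Proof. exact: cvg_comp a_infty. Qed.

Lemma norming_gt0 : \forall t \near +oo, 0 < a t.
Proof. by move/cvgryPgt : a_infty; apply. Qed.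

Let Ua_gt0 : \forall t \near +oo, 0 < U (a t).
Proof. exact: near_norming (tmoment2_gt0 X_pos X_mu2). Qed.

(** The defining relation of a, transferred from [ltilde l] to its equivalent U / 2. *)
Lemma norming_tmoment2 : t * U (a t) / a t ^+ 2 @[t --> +oo] --> (2 : R).
Proof.
have E := ltilde_equiv X_pos X_pareto X_mu2 l_int.
have gt0 : \forall x \near +oo, 0 < ltilde l x / U x.
  by have /cvgr_gt := E; apply; rewrite invr_gt0.
have h : (t * a t ^- 2 * ltilde l (a t)) / (ltilde l (a t) / U (a t))
    @[t --> +oo] --> (1 / 2^-1 : R).
  apply: cvgM => //; apply: cvgV; first by rewrite invr_neq0.
  exact: cvg_norming E.
rewrite mul1r invrK in h; apply: near_eq_cvg_pinfty h _; near=> t.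
have Ut : 0 < U (a t) by near: t.
have at0 : 0 < a t by near: t; exact: norming_gt0.
have lt : 0 < ltilde l (a t).
  have : 0 < ltilde l (a t) / U (a t) by near: t; exact: near_norming gt0.
  by rewrite pmulr_lgt0// invr_gt0.
by field; rewrite !gt_eqF.
Unshelve. all: end_near. Qed.

(** The expression equals [(t * U (a t) / a t ^ 2) * (W (c * a t) / U (a t)) / c ^ 2]. It holds for
    every c, so among order t observations even the largest is negligible against [a t]. *)
Lemma norming_tail c : 0 < c -> t * tail X (c * a t) @[t --> +oo] --> (0 : R).
Proof.
move=> c0.
have h : t * U (a t) / a t ^+ 2 * (W (c * a t) / U (a t)) * c ^- 2
    @[t --> +oo] --> (2 * 0 * c ^- 2 : R).
  apply: cvgM; last exact: cvg_cst.
  apply: cvgM; first exact: norming_tmoment2.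
  exact: cvg_norming (scaled_tail_negligibleZ X_pos X_pareto X_mu2 c0).
rewrite mulr0 mul0r in h; apply: near_eq_cvg_pinfty h _; near=> t.
have Ut : 0 < U (a t) by near: t.
have at0 : 0 < a t by near: t; exact: norming_gt0.
by rewrite /scaled_tail; field; rewrite !gt_eqF.
Unshelve. all: end_near. Qed.

Lemma norming_tmoment4 : t * tmoment X 4 (a t) / a t ^+ 4 @[t --> +oo] --> (0 : R).
Proof.
apply/cvgrPdist_le => e e0.
(* As c <= 1, [c ^ 2 <= e / 8]; with [t * U (a t) / a t ^ 2 <= 3] ultimately and the tail term at
   most e / 2, the total is at most 7 e / 8. *)
pose c : R := Num.min 1 (e / 8).
have c0 : 0 < c by rewrite lt_min ltr01 divr_gt0.
have c1 : c <= 1 by rewrite ge_min lexx.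
have ce : c <= e / 8 by rewrite ge_min lexx orbT.
have e2 : 0 < e / 2 by rewrite divr_gt0.
have /cvgrPdist_le/(_ _ e2) T1 := norming_tail c0.
have /cvgrPdist_le/(_ _ ltr01) U1 := norming_tmoment2.
near=> t.
have t0 : 0 < t by near: t; exact: nbhs_pinfty_gt.
have at0 : 0 < a t by near: t; exact: norming_gt0.
have Tt : `|0 - t * tail X (c * a t)| <= e / 2 by near: t.
have Ut : `|2 - t * U (a t) / a t ^+ 2| <= 1 by near: t.
have c01 : 0 <= c <= 1 by rewrite c1 ltW.
have Q := tmoment4_le X c01 (ltW at0).
rewrite sub0r normrN ger0_norm; last first.
  by rewrite divr_ge0 ?exprn_ge0 ?mulr_ge0 ?tmoment_ge0// ltW.
have a4 : 0 < a t ^+ 4 by rewrite exprn_gt0.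
apply: le_trans (_ : c ^+ 2 * (t * U (a t) / a t ^+ 2) + t * tail X (c * a t) <= _).
  rewrite ler_pdivrMr//.
  rewrite (_ : _ * a t ^+ 4 = t * ((c * a t) ^+ 2 * U (a t) + a t ^+ 4 * tail X (c * a t))).
    by rewrite ler_pM2l.
  by field; rewrite gt_eqF.
have t3 : t * U (a t) / a t ^+ 2 <= 3 by move: Ut; rewrite ler_norml => /andP[]; lra.
have tt : t * tail X (c * a t) <= e / 2 by move: Tt; rewrite ler_norml => /andP[]; lra.
have c2 : c ^+ 2 <= e / 8.
  by apply: le_trans ce; rewrite expr2 ler_piMl// ltW.
have : c ^+ 2 * (t * U (a t) / a t ^+ 2) <= e / 8 * 3.
  apply: ler_pM => //; first exact: sqr_ge0.
  by rewrite divr_ge0 ?exprn_ge0 ?mulr_ge0 ?tmoment_ge0// ltW.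
lra.
Unshelve. all: end_near. Qed.

(** As t is of order [a t ^ 2 / U (a t)], the ratio [U (a t) / t] is of order [(U (a t) / a t) ^ 2],
    which vanishes by sublinearity of U. *)
Lemma norming_tmoment2_sub : U (a t) / t @[t --> +oo] --> (0 : R).
Proof.
have h1 : (U (a t) / a t) / (t * U (a t) / a t ^+ 2) @[t --> +oo] --> (0 / 2 : R).
  apply: cvgM.
    exact: cvg_norming (tmoment2_sublinear X_pos X_pareto).
  by apply: cvgV; [rewrite pnatr_eq0|exact: norming_tmoment2].
have h : (t * U (a t) / a t ^+ 2) *
  (((U (a t) / a t) / (t * U (a t) / a t ^+ 2)) *
   ((U (a t) / a t) / (t * U (a t) / a t ^+ 2)))
    @[t --> +oo] --> (2 * ((0 / 2) * (0 / 2)) : R).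
  by apply: cvgM; [exact: norming_tmoment2|exact: cvgM].
rewrite mul0r mulr0 mulr0 in h; apply: near_eq_cvg_pinfty h _; near=> t.
have Ut : 0 < U (a t) by near: t.
have at0 : 0 < a t by near: t; exact: norming_gt0.
have t0 : 0 < t by near: t; exact: nbhs_pinfty_gt.
by field; rewrite !gt_eqF.
Unshelve. all: end_near. Qed.

(** The ratio is [(t * U (a t) / a t ^ 2) / U (a t)] and U diverges. This is what makes the sample
    mean disappear from the rescaled dispersion. *)
Lemma norming_superlinear : t / a t ^+ 2 @[t --> +oo] --> (0 : R).
Proof.
have Uy : U (a t) @[t --> +oo] --> +oo.
  exact: cvg_comp a_infty (cvg_tmoment2 X_pos X_mu2).
have UV : (U (a t))^-1 @[t --> +oo] --> (0 : R) by apply/gtr0_cvgV0.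
have h : (t * U (a t) / a t ^+ 2) * (U (a t))^-1 @[t --> +oo] --> (2 * 0 : R).
  by apply: cvgM => //; exact: norming_tmoment2.
rewrite mulr0 in h; apply: near_eq_cvg_pinfty h _; near=> t.
have Ut : 0 < U (a t) by near: t.
have at0 : 0 < a t by near: t; exact: norming_gt0.
by field; rewrite !gt_eqF.
Unshelve. all: end_near. Qed.

Lemma norming_tmoment1 : M (a t) @[t --> +oo] --> fine 'E_P[X]%E.
Proof. exact: cvg_norming (cvg_tmoment1 X_pos X_pareto). Qed.

End norming_function.

(** * Events evaluated at an independent random index *)

Section random_index.
Context d (T : measurableType d) (R : realType) (P : probability T R).

Lemma measurable_index (Nt : {mfun T >-> nat}) (D : set nat) :
  measurable (Nt @^-1` D).
Proof. exact: measurable_funPTI. Qed.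

Lemma prob_random_index (Nt : {mfun T >-> nat}) (B : nat -> set T) (b : R) k :
  (forall n, measurable (B n)) -> 0 <= b ->
  (forall n, P (Nt @^-1` [set n] `&` B n) = (P (Nt @^-1` [set n]) * P (B n))%E) ->
  (forall n, (n < k)%N -> prob P (B n) <= b) ->
  measurable [set w | (Nt w < k)%N /\ B (Nt w) w] /\
  prob P [set w | (Nt w < k)%N /\ B (Nt w) w] <= b.
Proof.
move=> mB b0 ind Bb.
have mS j : measurable [set w | (Nt w < j)%N].
  exact: (measurable_index Nt [set n | (n < j)%N]).
have mE n := measurable_index Nt [set n].
(* Keeping the mass of [Nt w < k] in the bound makes it additive over the values of the index, so
   induction on k goes through. *)
suff [mk hk] : measurable [set w | (Nt w < k)%N /\ B (Nt w) w] /\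
    prob P [set w | (Nt w < k)%N /\ B (Nt w) w] <= b * prob P [set w | (Nt w < k)%N].
  by split=> //; apply: le_trans hk _; rewrite ler_piMr// prob_le1.
elim: k Bb => [_|k IH Bb].
  rewrite (_ : [set w | _] = set0); last by apply/seteqP; split=> // w [].
  by split=> //; rewrite /prob measure0 mulr_ge0// fine_ge0.
have {IH} [|mk hk] := IH; first by move=> n nk; exact: Bb (ltnW nk).
have mI : measurable (Nt @^-1` [set k] `&` B k) by exact: measurableI.
have UE : [set w | (Nt w < k.+1)%N /\ B (Nt w) w] =
    [set w | (Nt w < k)%N /\ B (Nt w) w] `|` (Nt @^-1` [set k] `&` B k).
  apply/seteqP; split=> w /=.
    by rewrite ltnS leq_eqVlt => -[/orP[/eqP <-|] ?]; [right|left].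
  by move=> [[/ltnW]|[<-]].
split; first by rewrite UE; exact: measurableU.
have -> : prob P [set w | (Nt w < k.+1)%N] =
    prob P [set w | (Nt w < k)%N] + prob P (Nt @^-1` [set k]).
  rewrite /prob -fineD ?fin_num_measure//; congr fine.
  rewrite -measureU//; first congr (P _).
    apply/seteqP; split=> w /=.
      by rewrite ltnS leq_eqVlt => /orP[/eqP <-|]; [right|left].
    by move=> [/ltnW|<-].
  by apply/seteqP; split=> w // [/= wk wE]; rewrite wE ltnn in wk.
apply: le_trans (_ : prob P [set w | (Nt w < k)%N /\ B (Nt w) w] +
   prob P (Nt @^-1` [set k] `&` B k) <= _).
  by apply: le_probU => //; rewrite UE//; exact: measurableU.
rewrite mulrDr lerD//.
have -> : prob P (Nt @^-1` [set k] `&` B k) = prob P (Nt @^-1` [set k]) * prob P (B k).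
  by rewrite {1}/prob ind fineM// fin_num_measure.
by rewrite mulrC ler_wpM2r ?prob_ge0// Bb.
Qed.

End random_index.

Section sample_events.
Context d (T : measurableType d) (R : realType) (P : probability T R).
Variables (X : {RV P >-> R}) (Xs : nat -> {RV P >-> R}).
Hypothesis X_pos : P [set w | 0 < X w] = 1%E.
Hypothesis Xs_iid : iid_copies P X Xs.

(** Nonpositive values are excluded as well, so that truncation at a acts as the identity on what
    remains; they have probability 0. *)
Let outside a i := [set w | ~~ (0 < Xs i w <= a)].

Let outsideE a i : outside a i = Xs i @^-1` (~` `]0, a]).
Proof. by apply/seteqP; split=> w /=; rewrite /outside/= in_itv/= => /negP. Qed.

Let measurable_outside a i : measurable (outside a i).
Proof. by rewrite outsideE; apply: measurable_funPTI; exact: measurableC. Qed.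

Let prob_outside a i : prob P (outside a i) <= tail X a.
Proof.
have mC : measurable (~` `]0, a]%classic : set R) by exact: measurableC.
rewrite outsideE /prob; have [_ /(_ i _ mC)] := Xs_iid.
rewrite /distribution /pushforward => ->; rewrite -/(prob P _).
apply: le_trans (_ : prob P [set w | X w <= 0] + tail X a <= _); last first.
  by rewrite -fine_cdfE (fine_cdf0 X_pos) add0r.
apply: le_probU.
- exact: measurable_funPTI.
- exact: measurable_le_RV.
- exact: measurable_gt_RV.
- move=> w /=; rewrite in_itv/= => /negP; rewrite negb_and -leNgt -ltNge.
  by move=> /orP.
Qed.

Let exists_outside a n := [set w | exists2 i, (i < n)%N & outside a i w].

Let prob_exists_outside a n :
  measurable (exists_outside a n) /\ prob P (exists_outside a n) <= n%:R * tail X a.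
Proof.
elim: n => [|n [mn hn]].
  rewrite (_ : exists_outside a 0 = set0); last by apply/seteqP; split=> // w [].
  by rewrite /prob measure0 mul0r.
have UE : exists_outside a n.+1 = exists_outside a n `|` outside a n.
  apply/seteqP; split=> w.
    by move=> [i]; rewrite ltnS leq_eqVlt => /orP[/eqP ->|ni oi]; [right|left; exists i].
  by move=> [[i ni oi]|on]; [exists i => //; exact: ltnW|exists n].
have mU : measurable (exists_outside a n.+1).
  by rewrite UE; apply: measurableU => //; exact: measurable_outside.
split=> //; rewrite -natr1 mulrDl mul1r.
apply: le_trans (lerD hn (prob_outside a n)).
by apply: le_probU => //; rewrite UE.
Qed.

Lemma measurable_stat_ge (f : T -> R) (c e : R) : measurable_fun setT f ->
  measurable [set w | e <= `|f w - c|].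
Proof.
move=> mf; rewrite (_ : [set w | _] = (fun w => `|f w - c|) @^-1` `[e, +oo[).
  rewrite -[X in measurable X]setTI.
  have : measurable_fun setT (fun w => `|f w - c|).
    by apply: measurableT_comp => //; exact: measurable_funB.
  by apply=> //; exact: measurable_itv.
by apply/seteqP; split=> w /=; rewrite in_itv/= andbT.
Qed.

(** On samples inside ]0, a] truncation changes nothing, so the event B forces an observation
    outside or a large deviation of a truncated sum. The three terms are the union bound, Chebyshev
    for the squares and Chebyshev for the observations. *)
Lemma prob_atypical_sample (n : nat) (t a eta : R) (B : set T) :
  0 < t -> 0 < a -> 0 < eta -> measurable B ->
  (forall w, (forall i, (i < n)%N -> 0 < Xs i w <= a) ->
     `|\sum_(i < n) Xs i w ^+ 2 - n%:R * tmoment X 2 a| < eta * a ^+ 2 ->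
     `|\sum_(i < n) Xs i w - n%:R * tmoment X 1 a| < eta * t -> ~ B w) ->
  prob P B <= n%:R * (tail X a + tmoment X 4 a / (eta * a ^+ 2) ^+ 2 +
                      tmoment X 2 a / (eta * t) ^+ 2).
Proof.
move=> t0 a0 eta0 mB HB.
have a2 : 0 < eta * a ^+ 2 by rewrite mulr_gt0// exprn_gt0.
have et : 0 < eta * t by rewrite mulr_gt0.
have mt2 : measurable_fun setT (fun x : R => trunc a x ^+ 2).
  by apply: measurable_funX; exact: measurable_trunc.
have t0' x : 0 <= trunc a x by exact: trunc_ge0 (ltW a0).
have t2 x : trunc a x ^+ 2 <= a ^+ 2.
  by rewrite lerXn2r ?nnegrE ?trunc_le ?(ltW a0).
have h2 := iid_sum_chebyshev Xs_iid mt2 (fun x => sqr_ge0 (trunc a x)) t2 n a2.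
have h1 := iid_sum_chebyshev Xs_iid (measurable_trunc a) t0' (trunc_le a) n et.
set A2 := [set w | _] in h2; set A1 := [set w | _] in h1.
have {}h2 : prob P A2 <= n%:R * tmoment X 4 a / (eta * a ^+ 2) ^+ 2.
  apply: le_trans h2 _; rewrite [X in n%:R * X](_ : _ = tmoment X 4 a)//.
  by apply: eq_Rintegral => w _; rewrite -exprM.
have {}h1 : prob P A1 <= n%:R * tmoment X 2 a / (eta * t) ^+ 2 by [].
have mA2 : measurable A2.
  apply: measurable_stat_ge; apply: measurable_sum => i.
  exact: (measurableT_comp mt2).
have mA1 : measurable A1.
  apply: measurable_stat_ge; apply: measurable_sum => i.
  exact: (measurableT_comp (measurable_trunc a)).
have [mE hE] := prob_exists_outside a n.
have sub : B `<=` exists_outside a n `|` (A2 `|` A1).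
  move=> w Bw; apply: contrapT => /not_orP[nE /not_orP[n2 n1]].
  have inn i : (i < n)%N -> 0 < Xs i w <= a.
    by move=> ni; apply: contrapT => /negP ?; apply: nE; exists i.
  have tE (i : 'I_n) : trunc a (Xs i w) = Xs i w.
    by apply: trunc_id; have /andP[/ltW -> ->] := inn i (ltn_ord i).
  apply: (HB w inn) => //.
    rewrite ltNge; apply/negP => h; apply: n2; rewrite /A2 /=.
    by under eq_bigr do rewrite tE.
  rewrite ltNge; apply/negP => h; apply: n1; rewrite /A1 /=.
  by under eq_bigr do rewrite tE.
have mU : measurable (A2 `|` A1) by exact: measurableU.
apply: le_trans (le_probU P mB mE mU sub) _.
have := le_probU P mU mA2 mA1 (@subset_refl _ _).
rewrite !mulrDr !mulrA; move: h1 h2 hE; lra.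
Qed.

End sample_events.

(** * Independence and tightness of the sample size *)

Section random_sample.
Context d d' (T : measurableType d) (T' : measurableType d') (R : realType).
Context (P : probability T R) (P' : probability T' R).
Variables (Xs : nat -> {RV P >-> R}) (N : R -> {mfun T >-> nat}).
Hypothesis N_indep : independent_process P N Xs.

Lemma independent_index t n (B : set T) : 0 <= t -> sigma_of setT Xs B ->
  P (N t @^-1` [set n] `&` B) = (P (N t @^-1` [set n]) * P B)%E.
Proof.
move=> t0 sB; apply: N_indep => //; apply: sub_sigma_algebra.
by exists t => //; exists [set n] => //; rewrite setTI.
Qed.

(** Independence speaks of events of the sigma-algebra generated by [Xs]. Measurability of the
    statistic is therefore replayed on [T] equipped with that smaller sigma-algebra, which is why it
    is assumed over all measurable types. *)
Lemma sigma_of_sample_stat (stat : (nat -> R) -> nat -> R) n (k c e : R) :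
  (forall d0 (T0 : measurableType d0) (Y : nat -> {mfun T0 >-> R}),
     measurable_fun setT (fun w => stat (Y ^~ w) n)) ->
  sigma_of setT Xs [set w | e < `|k * stat (Xs ^~ w) n - c|].
Proof.
move=> mstat.
pose G := \bigcup_(i in setT) preimage_set_system setT (Xs i) measurable.
have mXs i : measurable_fun (setT : set (g_sigma_algebraType G)) (Xs i).
  by move=> _ B mB; apply: sub_sigma_algebra; exists i => //; exists B.
pose Ys i : {mfun g_sigma_algebraType G >-> R} := mfun_Sub (mem_set (mXs i)).
have := mstat _ _ Ys.
have -> : [set w | e < `|k * stat (Xs ^~ w) n - c|] =
    setT `&` (fun w => `|k * stat (Ys ^~ w) n - c|) @^-1` `]e, +oo[.
  by rewrite setTI; apply/seteqP; split=> w /=; rewrite in_itv/= andbT.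
move=> ms; have : measurable_fun (setT : set (g_sigma_algebraType G))
    (fun w => `|k * stat (Ys ^~ w) n - c|).
  apply: measurableT_comp => //; apply: measurable_funB => //.
  by apply: measurable_funM.
by apply=> //; exact: measurable_itv.
Qed.

(** Positivity of [L] yields [dlt] and finiteness yields [K]. Both are chosen among the continuity
    points of the limit, where convergence in distribution gives information. *)
Lemma D_averages_tight (L : {RV P' >-> R}) (h : R) :
  D_averages_in_time P P' N L -> 0 < h ->
  exists dlt K : R, [/\ 0 < dlt, 0 < K & \forall t \near +oo,
    prob P [set w | ~~ (dlt * t <= (N t w)%:R <= K * t)] <= h].
Proof.
move=> [L0 NL] h0; have h4 : 0 < h / 4 by rewrite divr_gt0.
have [r r0 Hr] := fine_cdf_right L 0 h4.
have [dlt /andP[d0 dr] cd] := exists_continuity_point L r0.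
have {Hr dr} : fine (cdf L dlt) < fine (cdf L 0) + h / 4 by apply: Hr; rewrite add0r.
rewrite (fine_cdf0 L0) add0r => Ld.
have [K0 [K00 LK0]] : exists K0, 0 < K0 /\ 1 - h / 4 < fine (cdf L K0).
  have /fine_cvgP[_] := cvg_cdfy1 L.
  move=> /cvgrPdist_lt/(_ _ h4) LK.
  apply: (@filter_ex _ (+oo : set_system R)); near=> K0; split.
    by near: K0; exact: nbhs_pinfty_gt.
  have : `|1 - (fine \o cdf L) K0| < h / 4 by near: K0.
  by rewrite ltr_norml => /andP[_]; rewrite /=; lra.
have [K /andP[KK0 _] cK] := @exists_continuity_point _ _ _ _ L K0 (K0 + 1) ltac:(lra).
have LK : 1 - h / 4 < fine (cdf L K) by apply: lt_le_trans LK0 (le_fine_cdf L (ltW KK0)).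
exists dlt, K; split => //; first exact: lt_trans KK0.
pose A t : {RV P >-> R} := cst t^-1 \* countR (N t).
have AL : cvg_in_dist P P' A L by [].
have := AL dlt cd; rewrite [in X in _ --> X -> _](cdfE L) => /fine_cvgP[_] /cvgrPdist_lt/(_ _ h4) Nd.
have := AL K cK; rewrite [in X in _ --> X -> _](cdfE L) => /fine_cvgP[_] /cvgrPdist_lt/(_ _ h4) NK.
near=> t.
have t0 : 0 < t by near: t; exact: nbhs_pinfty_gt.
have Ad : `|fine (cdf L dlt) - fine (cdf (A t) dlt)| < h / 4 by near: t.
have AK : `|fine (cdf L K) - fine (cdf (A t) K)| < h / 4 by near: t.
have AE w : A t w = (N t w)%:R / t by rewrite /A /= /countR mulrC.
apply: le_trans (_ : prob P [set w | A t w <= dlt] + prob P [set w | K < A t w] <= _).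
  apply: le_probU.
  - exact: (measurable_index (N t) [set n | ~~ (dlt * t <= n%:R <= K * t)]).
  - exact: measurable_le_RV.
  - exact: measurable_gt_RV.
  - have sub w : ~~ (dlt * t <= (N t w)%:R <= K * t) -> A t w <= dlt \/ K < A t w.
      rewrite negb_and -!ltNge AE ler_pdivrMr// ltr_pdivlMr//.
      by move=> /orP[/ltW|]; [left|right].
    exact: sub.
rewrite -fine_cdfE -/(tail (A t) K) tailE.
move: Ad AK; rewrite !ltr_norml => /andP[? ?] /andP[? ?].
lra.
Unshelve. all: end_near. Qed.

End random_sample.

(** * Convergence in probability of the rescaled statistics *)

Section convergence_in_probability.
Context d d' (T : measurableType d) (T' : measurableType d') (R : realType).
Context (P : probability T R) (P' : probability T' R).
Variables (X : {RV P >-> R}) (Xs : nat -> {RV P >-> R}).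
Variables (N : R -> {mfun T >-> nat}) (L : {RV P' >-> R}) (l a : R -> R).
Hypothesis X_pos : P [set w | 0 < X w] = 1%E.
Hypothesis Xs_iid : iid_copies P X Xs.
Hypothesis N_indep : independent_process P N Xs.
Hypothesis X_pareto : pareto_type P X 2 l.
Hypothesis X_mu2 : ('E_P[(X : T -> R) ^+ 2] = +oo)%E.
Hypothesis N_averages : D_averages_in_time P P' N L.
Hypothesis l_int : forall x : R, 0 < x ->
  lebesgue_measure.-integrable `]0, x] (fun u : R => (l u / u)%:E).
Hypothesis a_infty : a t @[t --> +oo] --> +oo.
Hypothesis a_def : t * a t ^- 2 * ltilde l (a t) @[t --> +oo] --> (1 : R).

Local Notation mu := (fine 'E_P[X]%E).

(** The statistic is abstract so that [sample_C] and [sample_dispersion] share one argument: half of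
    h pays for sample sizes out of range, half for atypical samples. *)
Lemma cvg_in_probability_stat (stat : (nat -> R) -> nat -> R)
    (Q : R -> {RV P >-> R}) :
  (forall d0 (T0 : measurableType d0) (Y : nat -> {mfun T0 >-> R}) n,
     measurable_fun setT (fun w => stat (Y ^~ w) n)) ->
  concentrates stat ->
  (forall t w, Q t w = t / a t ^+ 2 * stat (Xs ^~ w) (N t w)) ->
  cvg_in_probability Q (2 / mu).
Proof.
move=> mstat close QE e h e0 h0.
have mu0 : 0 < mu := mean_gt0 X_pos X_pareto.
have h2 : 0 < h / 2 by rewrite divr_gt0.
have [dlt [K [d0 K0 tight]]] := D_averages_tight N_averages h2.
(* One entry for each of the last three conditions in [concentrates]. *)
pose eta := Num.min (dlt * mu / 4)
  (Num.min (e * mu ^+ 2 * dlt / (8 * (mu + 2))) (e / (4 * mu))).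
have m20 : 0 < 8 * (mu + 2) by rewrite mulr_gt0// addr_gt0.
have eta0 : 0 < eta.
  by rewrite !lt_min !divr_gt0// ?mulr_gt0// exprn_gt0.
have c1 : 4 * eta <= dlt * mu.
  by rewrite mulrC -ler_pdivlMr// ge_min lexx.
have c2 : 8 * (mu + 2) * eta <= e * mu ^+ 2 * dlt.
  by rewrite mulrC -ler_pdivlMr// !ge_min lexx orbT.
have c3 : 4 * eta * mu <= e.
  by rewrite mulrAC mulrC -ler_pdivlMr ?mulr_gt0// !ge_min lexx !orbT.
have eK : 0 < eta / K by rewrite divr_gt0.
have /cvgrPdist_le/(_ _ eK) nU := norming_tmoment2 X_pos X_pareto X_mu2 l_int a_infty a_def.
have /cvgrPdist_le/(_ _ eK) nM := norming_tmoment1 X_pos X_pareto a_infty.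
have /cvgrPdist_le/(_ _ eta0) nt :=
  norming_superlinear X_pos X_pareto X_mu2 l_int a_infty a_def.
(* This is the bound of [prob_atypical_sample] at the largest size [K * t], with t distributed over
   the terms so that each is a vanishing norming quantity. *)
have bnd : K * (t * tail X (a t) + t * tmoment X 4 (a t) / a t ^+ 4 / eta ^+ 2 +
    tmoment X 2 (a t) / t / eta ^+ 2) @[t --> +oo] -->
    (K * (0 + 0 / eta ^+ 2 + 0 / eta ^+ 2) : R).
  apply: cvgM; first exact: cvg_cst.
  apply: cvgD; first apply: cvgD.
  - have := norming_tail X_pos X_pareto X_mu2 l_int a_infty a_def ltr01.
    by under eq_fun do rewrite mul1r.
  - apply: cvgM; last exact: cvg_cst.
    exact: norming_tmoment4 X_pos X_pareto X_mu2 l_int a_infty a_def.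
  - apply: cvgM; last exact: cvg_cst.
    exact: norming_tmoment2_sub X_pos X_pareto X_mu2 l_int a_infty a_def.
rewrite !mul0r !addr0 mulr0 in bnd.
have /cvgrPdist_le/(_ _ h2) {}bnd := bnd.
have agt0 := norming_gt0 a_infty.
near=> t.
have t0 : 0 < t by near: t; exact: nbhs_pinfty_gt.
have at0 : 0 < a t by near: t.
have nUt : `|2 - t * tmoment X 2 (a t) / a t ^+ 2| <= eta / K by near: t.
have nMt : `|mu - tmoment X 1 (a t)| <= eta / K by near: t.
have ntt : t / a t ^+ 2 <= eta.
  have : `|0 - t / a t ^+ 2| <= eta by near: t.
  by rewrite sub0r normrN; apply: le_trans; exact: ler_norm.
rewrite distrC in nUt; rewrite distrC in nMt.
have bndt : K * (t * tail X (a t) + t * tmoment X 4 (a t) / a t ^+ 4 / eta ^+ 2 +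
    tmoment X 2 (a t) / t / eta ^+ 2) <= h / 2.
  have : `|0 - K * (t * tail X (a t) + t * tmoment X 4 (a t) / a t ^+ 4 / eta ^+ 2 +
    tmoment X 2 (a t) / t / eta ^+ 2)| <= h / 2 by near: t.
  by rewrite sub0r normrN; apply: le_trans; exact: ler_norm.
pose E n := [set w | e < `|t / a t ^+ 2 * stat (Xs ^~ w) n - 2 / mu|].
have mE n : measurable (E n).
  rewrite (_ : E n = setT `&`
      (fun w => `|t / a t ^+ 2 * stat (Xs ^~ w) n - 2 / mu|) @^-1` `]e, +oo[).
    have : measurable_fun setT (fun w => `|t / a t ^+ 2 * stat (Xs ^~ w) n - 2 / mu|).
      apply: measurableT_comp => //; apply: measurable_funB => //.
      by apply: measurable_funM => //; exact: mstat.
    by apply=> //; exact: measurable_itv.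
  by rewrite setTI; apply/seteqP; split=> w /=; rewrite in_itv/= andbT.
pose in_range n := dlt * t <= n%:R <= K * t.
(* Emptying the event outside the range makes the bound h / 2 hold for all n. *)
pose B n := if in_range n then E n else set0.
have mB n : measurable (B n) by rewrite /B; case: ifP.
have indB n : P (N t @^-1` [set n] `&` B n) = (P (N t @^-1` [set n]) * P (B n))%E.
  rewrite /B; case: ifP => _; last by rewrite setI0 !measure0 mule0.
  apply: (independent_index N_indep); first exact: ltW.
  by apply: sigma_of_sample_stat => d0' T0 Y; exact: mstat.
have Bh n : prob P (B n) <= h / 2.
  rewrite /B; case: ifPn => [/andP[nd nK]|_]; last first.
    by rewrite /prob measure0/= ltW.
  apply: le_trans bndt; apply: le_trans
    (prob_atypical_sample X_pos Xs_iid (n := n) t0 at0 eta0 (mE n) _) _.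
    move=> w inn s2 s1; rewrite /E/=; apply/negP; rewrite -leNgt.
    exact: (close _ _ _ _ _ _ _ _ _ _ _ t0 at0 mu0 d0 K0 eta0 e0 nd nK s2 s1).
  rewrite [leRHS](_ : _ = K * t * (tail X (a t) + tmoment X 4 (a t) / (eta * a t ^+ 2) ^+ 2 +
                      tmoment X 2 (a t) / (eta * t) ^+ 2)); last first.
    by field; rewrite !gt_eqF.
  apply: ler_wpM2r => //; rewrite !addr_ge0 ?tail_ge0//.
    by rewrite divr_ge0 ?sqr_ge0 ?tmoment_ge0 ?ltW.
  by rewrite divr_ge0 ?sqr_ge0 ?tmoment_ge0 ?ltW.
(* A natural number above [K * t], hence above every sample size in range. *)
pose k := (Num.truncn (K * t)).+1.
have [mk hk] := prob_random_index mB (ltW h2) indB (k := k) (fun n _ => Bh n).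
have mO : measurable [set w | ~~ (dlt * t <= (N t w)%:R <= K * t)].
  exact: (measurable_index (N t) [set n | ~~ (dlt * t <= n%:R <= K * t)]).
apply: le_trans (_ : prob P [set w | ~~ (dlt * t <= (N t w)%:R <= K * t)] +
  prob P [set w | (N t w < k)%N /\ B (N t w) w] <= _); last first.
  rewrite [leRHS](_ : h = h / 2 + h / 2); last by rewrite -splitr.
  by apply: lerD => //; near: t.
apply: le_probU => //; first exact: measurable_dist_RV.
move=> w /=; rewrite QE => ew.
case: (boolP (in_range (N t w))) => [inr|]; [right|by left].
split; last by rewrite /B inr.
have /andP[_ nK] := inr.
by rewrite /k -(ltr_nat R); apply: le_lt_trans nK _; exact: truncnS_gt.
Unshelve. all: end_near. Qed.

Lemma cvg_in_probability_sample_C :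
  cvg_in_probability (fun t => cst (t / a t ^+ 2) \* rC Xs (N t) : {RV P >-> R})
    (2 / mu).
Proof.
apply: (@cvg_in_probability_stat sample_C) => //.
- move=> d0 T0 Y n; exact: (measurable_rC Y (cst n)).
- exact: concentrates_statistics.1.
Qed.

Lemma cvg_in_probability_sample_dispersion :
  cvg_in_probability (fun t => cst (t / a t ^+ 2) \* rdispersion Xs (N t) : {RV P >-> R})
    (2 / mu).
Proof.
apply: (@cvg_in_probability_stat sample_dispersion) => //.
- move=> d0 T0 Y n; exact: (measurable_rdispersion Y (cst n)).
- exact: concentrates_statistics.2.
Qed.

End convergence_in_probability.

Unset Implicit Arguments.

Theorem mainTheorem16 (R : realType)
    (d : measure_display) (T : measurableType d) (P : probability T R)
    (d' : measure_display) (T' : measurableType d') (P' : probability T' R)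
    (X : {RV P >-> R}) (Xs : nat -> {RV P >-> R})
    (N : R -> {mfun T >-> nat}) (L : {RV P' >-> R})
    (l a : R -> R)
    (X_pos : P [set w | 0 < X w] = 1%E)
    (Xs_iid : iid_copies P X Xs)
    (N_counting : counting_process N)
    (N_indep : independent_process P N Xs)
    (X_pareto : pareto_type P X 2 l)
    (X_mu2 : ('E_P[X ^+ 2] = +oo)%E)
    (N_averages : D_averages_in_time P P' N L)
    (l_integrable : forall x : R, 0 < x ->
       lebesgue_measure.-integrable `]0, x] (fun u : R => (l u / u)%:E))
    (a_infty : a t @[t --> +oo] --> +oo)
    (a_def : t * a t ^- 2 * ltilde l (a t) @[t --> +oo] --> (1 : R)) :
  slowly_varying (ltilde l) /\
  [/\ cvg_in_dist P P'
        (fun t => cst (a t ^- 2) \* (countR (N t) \* rC Xs (N t)))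
        (cst (2 / fine 'E_P[X]%E) \* L),
      cvg_in_dist P P'
        (fun t => cst (a t ^- 2) \* (countR (N t) \* rdispersion Xs (N t)))
        (cst (2 / fine 'E_P[X]%E) \* L) &
      cvg_in_dist P P
        (fun t => cst (t / a t ^+ 2) \* rdispersion Xs (N t))
        (cst (2 / fine 'E_P[X]%E))].
Proof.
have c0 : 0 < 2 / fine 'E_P[X]%E by rewrite divr_gt0// (mean_gt0 X_pos X_pareto).
have [L0 NL] := N_averages.
have QC := cvg_in_probability_sample_C X_pos Xs_iid N_indep X_pareto X_mu2
  N_averages l_integrable a_infty a_def.
have QD := cvg_in_probability_sample_dispersion X_pos Xs_iid N_indep X_pareto X_mu2
  N_averages l_integrable a_infty a_def.
have A0 : \forall t \near +oo, forall w, 0 <= (cst t^-1 \* countR (N t)) w :> R.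
  near=> t; move=> w; rewrite /= /countR mulr_ge0// invr_ge0.
  by near: t; exact: nbhs_pinfty_ge.
split; first exact: ltilde_slowly_varying X_pos X_pareto X_mu2 l_integrable.
split.
(* For t nonzero the statistic factors as N(t)/t times [t / a t ^ 2] times [rC]. *)
- apply: (cvg_in_dist_mul c0 L0 A0 _ _ NL QC) => //.
  near=> t; move=> w /=.
  have t0 : t != 0 by rewrite gt_eqF//; near: t; exact: nbhs_pinfty_gt.
  by rewrite [RHS]mulrACA mulKf.
- apply: (cvg_in_dist_mul c0 L0 A0 _ _ NL QD) => //.
  near=> t; move=> w /=.
  have t0 : t != 0 by rewrite gt_eqF//; near: t; exact: nbhs_pinfty_gt.
  by rewrite [RHS]mulrACA mulKf.
(* Convergence in probability to a constant implies convergence in distribution: this is the product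
   argument with the first factor constantly 1. *)
- pose one : {RV P >-> R} := cst 1.
  have one0 : P [set w | 0 < one w] = 1%E.
    rewrite -(probability_setT P); congr (P _).
    by apply/seteqP; split=> w //= _; exact: ltr01.
  have one_cvg : cvg_in_dist P P (fun=> one) one by exact: (cvg_in_dist_cst (a := 1)).
  apply: (cvg_in_dist_mul c0 one0 _ _ _ one_cvg QD).
  + by near=> t; move=> w; exact: ler01.
  + by near=> t; move=> w; rewrite /= mul1r.
  + by move=> w; rewrite /= mulr1.
Unshelve. all: end_near. Qed.
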